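(* Let $\mathcal{M}_\Sigma$ be a trace monoid with $\Sigma=\{a_1,\dots,a_n\}$, and write $\Sigma_k=\{a_1,\dots,a_k\}$ ($\Sigma_0=\emptyset$). For integers $0\leqslant k<\ell\leqslant n$ and $p\in(0,p_{\Sigma_k})$, consider the recursive randomized procedure $\mathrm{A}_2(p,k,\ell)$: if $\Sigma_k\cap\mathscr{L}(a_\ell)=\emptyset$, return $\mathbf{e}$. Otherwise set $\xi=\mathbf{e}$; let $\Sigma'_k$ be the connected component of $a_k$ in the graph $(\Sigma_k,\mathcal{R}\cap(\Sigma_k\times\Sigma_k))$; set $r=1-\mu_{\Sigma_k}(p)/\mu_{\Sigma_{k-1}}(p)$ if $\Sigma'_k\cap\mathscr{L}(a_\ell)\neq\emptyset$ and $r=0$ otherwise. Repeat: draw $R\in\{0,1\}$ with $\mathbb{P}(R=1)=r$ and compute $v_\infty=\mathrm{A}_2(p,k-1,\ell)$ (fresh independent randomness each time); until $R=0$, or $a_k\in\mathscr{L}(a_\ell)$, or $v_\infty\notin\mathcal{M}_{\Sigma_{k-1}\setminus\mathscr{L}(a_k)}$. If $R=1$, set $K=1+G$ with $\mathbb{P}(G=j)=(1-r)r^j$ ($j\geqslant0$); else $K=0$. For $i=1,\dots,K$ compute $v_i=\mathrm{A}_2(p,k-1,k)$ independently and set $\xi\gets\xi\cdot v_i\cdot a_k$. Finally set $\xi\gets\xi\cdot v_\infty$ and return $\xi$. Then: the output of $\mathrm{A}_2(p,k,\ell)$ has law $D^{p}_{\Sigma_k,\mathscr{L}(a_\ell)}$.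 Let $L(k,\ell)$ be the length of the output and $S(k,\ell)$ the number of steps of an execution, under the cost model in which all numbers $\mu_X(p)$ are precomputed, each non-recursive line of the procedure (including computing $\Sigma'_k$ and drawing $R$) costs a constant number of steps, and drawing an integer with value $X$ costs at most a constant times $X+1$ steps. Then $L(k,\ell)$ and $S(k,\ell)$ have finite variances, $$\mathbb{E}[S(k,\ell)]=\mathcal{O}\!\left(\frac{\max(k,1)}{\mu_{\Sigma_k}(p)}\right)\quad\text{(with a constant depending only on the cost model)},$$ and $$\mathbb{E}[L(k,\ell)]=p\left(\frac{\mu'_{\Sigma_k\setminus\mathscr{L}(a_\ell)}(p)}{\mu_{\Sigma_k\setminus\mathscr{L}(a_\ell)}(p)}-\frac{\mu'_{\Sigma_k}(p)}{\mu_{\Sigma_k}(p)}\right).$$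
   Context: Let $\Sigma$ be a finite alphabet and $\mathcal{R}$ a reflexive and symmetric binary relation on $\Sigma$. The trace monoid $\mathcal{M}_\Sigma$ is the quotient of $\Sigma^*$ by the congruence generated by $ab=ba$ for all $(a,b)\notin\mathcal{R}$; unit $\mathbf{e}$. For $\Sigma'\subseteq\Sigma$, $\mathcal{M}_{\Sigma'}$ is the submonoid generated by $\Sigma'$. $|x|$ is the length of $x$; $\max(x)$ is the set of letters $a$ with $x=y\cdot a$ for some trace $y$. $\mathscr{L}(a)=\{b\in\Sigma:(a,b)\in\mathcal{R}\}$. For $S\subseteq\Sigma$, a clique of $S$ is a subset of $S$ of pairwise non-$\mathcal{R}$-related letters (empty set included); $\mu_S(X)=\sum_{\gamma\text{ clique of }S}(-1)^{|\gamma|}X^{|\gamma|}$, $\mu_\emptyset=1$, and $\mu'_S$ is its derivative. For $S\neq\emptyset$, $p_S$ is the unique root of smallest modulus of $\mu_S$ (real, $0<p_S\leqslant1$); $p_\emptyset=+\infty$; $p_S\leqslant p_{S'}$ when $S'\subseteq S$. For $p\in(0,p_S)$, $\sum_{x\in\mathcal{M}_S}p^{|x|}=1/\mu_S(p)<\infty$, and $B_{S,p}$ is the probability distribution on $\mathcal{M}_S$ with $B_{S,p}(\{x\})=\mu_S(p)p^{|x|}$. $D^{p}_{S,T}=B_{S,p}(\,\cdot\mid\max(\xi)\subseteq T)$. *)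

(* Defs.v *)
From HB Require Import structures.
From mathcomp Require Import all_boot all_order all_algebra.
From mathcomp Require Import all_classical all_reals all_analysis.
From mathcomp Require Import complex.
From Stdlib Require Import Relations.

Set Implicit Arguments.
Unset Strict Implicit.
Unset Printing Implicit Defensive.

Import Order.TTheory GRing.Theory Num.Theory.
Local Open Scope ring_scope.
Local Open Scope classical_set_scope.

(* Conventions.  The alphabet Sigma = {a_1,...,a_n} is encoded by the natural
   numbers 0,...,n-1 : the letter a_i is the number i-1.  Hence
   Sigma_k = {a_1,...,a_k} is the set of numbers < k, a_k is k-1 and a_l is
   l-1.  Words are [seq nat]; the relation R is [Rel : rel nat] (only its
   restriction to Sigma matters). *)

Section Traces.
Variable Rel : rel nat.

Definition tr_step (u v : seq nat) : Prop :=
  exists s t a b, ~~ Rel a b /\ u = s ++ a :: b :: t /\ v = s ++ b :: a :: t.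

Definition tr_eq : relation (seq nat) := clos_refl_trans _ tr_step.

Definition maxl (x : seq nat) : set nat :=
  [set a | exists y, tr_eq x (rcons y a)].

(* lexicographic order on words, used to pick one representative per trace *)
Fixpoint lexle (x y : seq nat) : bool :=
  match x, y with
  | [::], _ => true
  | _ :: _, [::] => false
  | a :: x', b :: y' => (a < b)%N || ((a == b) && lexle x' y')
  end.

Definition tr_nf (x : seq nat) : Prop := forall y, tr_eq x y -> lexle x y.

Definition Lset (a : nat) : pred nat := [pred b | Rel a b].

Definition is_clique k (A : {set 'I_k}) : bool :=
  [forall a in A, forall b in A, (a != b) ==> ~~ Rel a b].

Definition mu_poly (F : nzRingType) k (P : pred nat) : {poly F} :=
  \sum_(A : {set 'I_k} | [forall a in A, P (val a)] && is_clique A)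
     ((-1) ^+ #|A|) *: 'X^#|A|.

End Traces.

(* p < p_{Sigma_k}  :  p is smaller than the modulus of every complex root of
   mu_{Sigma_k}  (vacuous when Sigma_k is empty, p_empty = +oo). *)
Definition below_pS (R : rcfType) (Rel : rel nat) (k : nat) (p : R) : Prop :=
  forall z : R[i], root (@mu_poly Rel R[i] k predT) z ->
    p < ComplexField.Normc.normc z.

Section Dist.
Variable R : realType.
Local Open Scope ereal_scope.

Definition dist (A : choiceType) := A -> \bar R.

Definition dret (A : choiceType) (a : A) : dist A :=
  fun x => if x == a then 1 else 0.

Definition dzero (A : choiceType) : dist A := fun _ => 0.

Definition dbind (A B : choiceType) (d : dist A) (f : A -> dist B) : dist B :=
  fun y => \esum_(x in [set: A]) d x * f x y.

Definition dflip (r : R) : dist bool :=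
  fun b => if b then r%:E else (1 - r)%:E.

Definition dgeom (r : R) : dist nat := fun j => ((1 - r) * r ^+ j)%:E.

(* expectation of a nonnegative real-valued quantity *)
Definition Ex (A : choiceType) (f : A -> R) (d : dist A) : \bar R :=
  \esum_(x in [set: A]) d x * (f x)%:E.

Definition finite_var (A : choiceType) (f : A -> R) (d : dist A) : Prop :=
  Ex f d < +oo /\ Ex (fun x => ((f x - fine (Ex f d)) ^+ 2)%R) d < +oo.

End Dist.
Arguments dret {R A}.
Arguments dzero {R A}.
Arguments dbind {R A B}.
Arguments dflip {R}.
Arguments dgeom {R}.
Arguments Ex {R A}.
Arguments finite_var {R A}.

(* Costs (in steps) of the non-recursive parts of the procedure:
   c_triv  : test "Sigma_k /\ L(a_l) = empty" and "return e"
   c_setup : the test, "xi = e", computing Sigma'_k, computing r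
   c_iter  : per iteration of the repeat loop: drawing R and the until-test
   c_draw G: the branch "R = 1": K = 1 + G, drawing the integer G
   c_K0    : the branch "R = 0": K = 0
   c_for   : per iteration of the for loop: xi <- xi . v_i . a_k
   c_end   : xi <- xi . v_oo and return *)
Record cost_model := CostModel {
  c_triv : nat; c_setup : nat; c_iter : nat; c_draw : nat -> nat;
  c_K0 : nat; c_for : nat; c_end : nat }.

Definition cost_bounded (c : nat) (cm : cost_model) : Prop :=
  (c_triv cm <= c)%N /\ (c_setup cm <= c)%N /\ (c_iter cm <= c)%N /\
  (c_K0 cm <= c)%N /\ (c_for cm <= c)%N /\ (c_end cm <= c)%N /\
  (forall X, (c_draw cm X <= c * X.+1)%N).

Section A2.
Variables (R : realType) (Rel : rel nat) (cm : cost_model) (p : R).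

Definition mu k (P : pred nat) : R := (@mu_poly Rel R k P).[p].
Definition mu' k (P : pred nat) : R := ((@mu_poly Rel R k P)^`()).[p].

(* the j+1 first iterations of the repeat loop, the last one being the
   first whose until-condition holds; outcome (R, v_oo, cost) *)
Fixpoint loopn (body : dist R ((bool * seq nat) * nat)%type)
    (stop : bool -> seq nat -> bool) (j : nat) : dist R ((bool * seq nat) * nat)%type :=
  match j with
  | 0 => dbind body (fun o => if stop o.1.1 o.1.2 then dret o else dzero)
  | j'.+1 => dbind body (fun o => if stop o.1.1 o.1.2 then dzero else
              dbind (loopn body stop j') (fun o' => dret (o'.1, (o.2 + o'.2)%N)))
  end.

Definition loop body stop : dist R ((bool * seq nat) * nat)%type :=
  fun o => \esum_(j in [set: nat]) loopn body stop j o.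

Fixpoint callsn (d : dist R (seq nat * nat)%type) (a : nat) (m : nat) :
    dist R (seq nat * nat)%type :=
  match m with
  | 0 => dret ([::], 0%N)
  | m'.+1 => dbind (callsn d a m') (fun xs => dbind d (fun vs =>
               dret (xs.1 ++ vs.1 ++ [:: a], (xs.2 + vs.2 + c_for cm)%N)))
  end.

(* A2 k l : joint law of (output, number of steps) of A_2(p,k,l).
   For k = k'.+1 : a_k is the letter k', Sigma_{k-1} = numbers < k'. *)
Fixpoint A2 (k l : nat) {struct k} : dist R (seq nat * nat)%type :=
  match k with
  | 0 => dret ([::], c_triv cm)
  | k'.+1 =>
    if ~~ [exists i : 'I_k'.+1, Rel l.-1 i] then dret ([::], c_triv cm) else
    let hit := [exists i : 'I_k'.+1,
                  connect (fun x y : 'I_k'.+1 => Rel x y) ord_max i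
                  && Rel l.-1 i] in
    let r : R := if hit then (1 - mu k'.+1 predT / mu k' predT)%R else 0%R in
    let stop (b : bool) (v : seq nat) :=
      ~~ b || Rel l.-1 k' || ~~ all (fun x => (x < k')%N && ~~ Rel k' x) v in
    let body : dist R ((bool * seq nat) * nat)%type :=
      dbind (dflip r) (fun b => dbind (A2 k' l) (fun vs =>
        dret ((b, vs.1), (vs.2 + c_iter cm)%N))) in
    let dK (b : bool) : dist R (nat * nat)%type :=
      if b then dbind (dgeom r) (fun G => dret (G.+1, c_draw cm G))
      else dret (0%N, c_K0 cm) in
    dbind (loop body stop) (fun o =>
    dbind (dK o.1.1) (fun Kc =>
    dbind (callsn (A2 k' k'.+1) k' Kc.1) (fun xs =>
    dret (xs.1 ++ o.1.2, (c_setup cm + o.2 + Kc.2 + xs.2 + c_end cm)%N))))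
  end.

Definition out_prob (d : dist R (seq nat * nat)%type) (x : seq nat) : \bar R :=
  \esum_(ws in [set ws : (seq nat * nat)%type | tr_eq Rel ws.1 x]) d ws.

(* B_{Sigma_k,p}(max(xi) \subset T) : sum over traces (one normal form each) *)
Definition Bmax k (T : pred nat) : \bar R :=
  \esum_(y in [set y | tr_nf Rel y /\ all (fun a => (a < k)%N) y /\
                       maxl Rel y `<=` T])
     (mu k predT * p ^+ size y)%:E.

(* D^p_{Sigma_k,T}({x}) = B_{Sigma_k,p}({x} | max(xi) \subset T) *)
Definition Dlaw k (T : pred nat) (x : seq nat) : R :=
  if all (fun a => (a < k)%N) x && `[< maxl Rel x `<=` T >]
  then (mu k predT * p ^+ size x / fine (Bmax k T))%R
  else 0%R.

End A2.

(* Main.v *)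
Require Import Defs.
From HB Require Import structures.
From mathcomp Require Import all_boot all_order all_algebra.
From mathcomp Require Import all_classical all_reals all_analysis.
From mathcomp Require Import complex polyrcf zify ring lra.

(* Cut a trace over a_1, ..., a_k just after each occurrence of a_k, pushing
   every letter as far to the right as possible: it factors uniquely as
   (v_1 a_k) ... (v_m a_k) v, where each v_i has its maximal letters in L(a_k)
   and a_k occurs neither in v nor in the v_i. Its maximal letters lie in T iff those of v do and,
   when m > 0, either a_k is in T or v does not commute with a_k. Iterating the
   factorization gives one word per trace, weighted by p^length in [lam]; summing
   geometric series in m yields the mass mu_{S \ T} / mu_S and the mean length.
   The procedure rebuilds this factorization: rejection conditions v, and K is
   geometric with ratio r = p mu_{S \ L(a_k)} / mu_S, the weight of a block.

   Costs: with rho the probability of rejecting one round, E N = 1 / (1 - rho)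
   and E K = (r - rho) / ((1 - rho) (1 - r)), so E N + E K = 1 / (1 - r) =
   mu_{k-1} / mu_k and E S(k) mu_k grows by a bounded amount with k. Variances
   are finite because some exponential moment is, by the same recursion. *)

Import Order.TTheory GRing.Theory Num.Theory.
Local Open Scope ring_scope.
Local Open Scope classical_set_scope.

Set Implicit Arguments.
Unset Strict Implicit.
Unset Printing Implicit Defensive.

(** The hypothesis on p concerns only the roots of mu_{Sigma_k}, whereas the computations divide by
    mu_P(p) for many subsets P of Sigma_k. All these values are shown positive by comparing first
    positive roots, and from then on p enters only through this positivity and p > 0.

    Sums live in [0, +oo], so that interchanging them is free; finiteness is established only where
    an equation has to be solved or a term subtracted.

    The law of the output is compared with [lam] up to a constant factor only. Since the procedure
    terminates with probability 1, total masses determine the factor, and the acceptance probability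
    of the repeat loop is never computed.

    For exponential moments the obstacle is that each rejected round and each further unit of K
    multiplies a moment b of a recursive call by r, so that the series converge only if r b < 1.
    Finiteness of b does not give this; shrinking the exponent does, because b then tends to 1 while
    r < 1 is fixed. *)

(** * Sums of nonnegative extended reals, and geometric series *)

Section NonnegSums.
Context {R : realType}.
Local Open Scope ereal_scope.

(** The factor +oo is treated apart: either all terms vanish, or a single positive term already
    makes both sides infinite. *)
Lemma ge0_esumZl (T : choiceType) (c : \bar R) (a : T -> \bar R) :
  0 <= c -> (forall t, 0 <= a t) ->
  \esum_(t in [set: T]) c * a t = c * \esum_(t in [set: T]) a t.
Proof.
move=> c0 a0; case: c c0 => [r| |//] r0.
- rewrite -ereal_supZl ?lee_fin//; last first.
    by apply/set0P; eexists; exists set0; [exact: fsets_set0|reflexivity].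
  congr ereal_sup; apply/seteqP; split=> x /=.
    move=> [A [fA _] <-]; exists (\sum_(t \in A) a t); first by exists A.
    by rewrite ge0_mule_fsumr.
  move=> [_ [A [fA _] <-] <-]; exists A => //.
  by rewrite ge0_mule_fsumr.
- have [a00|] := pselect (forall t, a t = 0).
    by rewrite !esum1 ?mule0// => t _; rewrite a00 ?mule0.
  move=> /existsNP[t /eqP at0]; have {}at0 : 0 < a t by rewrite lt_def at0 a0.
  have ge_t (f : T -> \bar R) : 0 <= f t -> f t <= \esum_(t in [set: T]) f t.
    move=> ft; apply: esum_ge; exists [set t]; last by rewrite fsbig_set1.
    by split => //; exact: finite_set1.
  rewrite gt0_mulye ?(lt_le_trans at0 (ge_t _ (a0 t)))//.
  apply/eqP; rewrite -leye_eq; apply: le_trans (ge_t _ _).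
    by rewrite gt0_mulye.
  by rewrite mule_ge0.
Qed.

Lemma ge0_esumZr (T : choiceType) (c : \bar R) (a : T -> \bar R) :
  0 <= c -> (forall t, 0 <= a t) ->
  \esum_(t in [set: T]) a t * c = (\esum_(t in [set: T]) a t) * c.
Proof.
by move=> c0 a0; rewrite muleC -ge0_esumZl//; apply: eq_esum => t _; rewrite muleC.
Qed.

Lemma exchange_esum (T1 T2 : choiceType) (a : T1 -> T2 -> \bar R) :
  (forall i j, 0 <= a i j) ->
  \esum_(i in [set: T1]) \esum_(j in [set: T2]) a i j =
  \esum_(j in [set: T2]) \esum_(i in [set: T1]) a i j.
Proof.
move=> a0; rewrite (esum_esum (J := fun=> setT))// (esum_esum (J := fun=> setT))//.
rewrite (reindex_esum ([set: T2] `*`` fun=> [set: T1]) _ (fun x => (x.2, x.1)))//.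
split=> //=.
  by move=> [i1 i2] [j1 j2] /= _ _ [] -> ->.
by move=> [i1 i2] _ /=; exists (i2, i1).
Qed.

Lemma esum_single (T : choiceType) (t : T) (a : T -> \bar R) :
  0 <= a t -> (forall s, s != t -> a s = 0) -> \esum_(s in [set: T]) a s = a t.
Proof.
move=> at0 a0; rewrite -(esum_set1 at0) [RHS]esum_mkcond.
apply: eq_esum => s _; case: ifPn => //; rewrite notin_setE /= => st.
by rewrite a0//; apply/eqP.
Qed.

Lemma esum_nat_le (a : nat -> \bar R) (M : \bar R) :
  (forall n, 0 <= a n) -> (forall n, \sum_(0 <= i < n) a i <= M) ->
  \esum_(i in [set: nat]) a i <= M.
Proof.
move=> a0 aM; rewrite -nneseries_esumT//.
by apply: lime_le; [exact: is_cvg_nneseries|exact: nearW].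
Qed.

Lemma esum_nat_recl (a : nat -> \bar R) : (forall n, 0 <= a n) ->
  \esum_(i in [set: nat]) a i = a 0%N + \esum_(i in [set: nat]) a i.+1.
Proof.
move=> a0; rewrite (esumID [set 0%N])// setTI esum_set1//; congr (_ + _).
rewrite (reindex_esum [set: nat] _ S)//; split=> //=.
  by move=> i j _ _ [].
by move=> [|i] [_ /= i0]; [|exists i].
Qed.

Lemma sum_geometric_le (q : R) : (0 <= q < 1)%R -> forall n : nat,
  (\sum_(0 <= i < n) q ^+ i <= (1 - q)^-1)%R.
Proof.
move=> /andP[q0 q1] n; have q1' : (0 < 1 - q)%R by rewrite subr_gt0.
rewrite -[leRHS]mul1r ler_pdivlMr//.
suff -> : ((\sum_(0 <= i < n) q ^+ i) * (1 - q) = 1 - q ^+ n)%R.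
  by rewrite gerBl exprn_ge0.
elim: n => [|n IH]; first by rewrite big_nil expr0; ring.
by rewrite big_nat_recr//= mulrDl IH exprS; ring.
Qed.

Lemma sum_geometric_deriv_le (q : R) : (0 <= q < 1)%R -> forall n : nat,
  (\sum_(0 <= i < n) i.+1%:R * q ^+ i <= ((1 - q) ^+ 2)^-1)%R.
Proof.
move=> /andP[q0 q1] n; have q1' : (0 < (1 - q) ^+ 2)%R by rewrite exprn_gt0// subr_gt0.
rewrite -[leRHS]mul1r ler_pdivlMr//.
suff -> : ((\sum_(0 <= i < n) i.+1%:R * q ^+ i) * (1 - q) ^+ 2 =
    1 - q ^+ n - n%:R * (1 - q) * q ^+ n)%R.
  have := exprn_ge0 n q0; have : (0 <= n%:R * (1 - q) * q ^+ n)%R.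
    by rewrite !mulr_ge0// ?exprn_ge0// subr_ge0 ltW.
  lra.
elim: n => [|n IH]; first by rewrite big_nil expr0; ring.
by rewrite big_nat_recr//= mulrDl IH !exprS -natr1; ring.
Qed.

(** The series below are evaluated by solving a shift equation such as s = 1 + q s, which +oo also
    satisfies. Bounded partial sums exclude that solution beforehand. *)
Lemma esum_fin (a : nat -> R) (M : R) : (forall n, 0 <= a n)%R ->
  (forall n, \sum_(0 <= i < n) a i <= M)%R ->
  exists2 s : R, (0 <= s)%R & \esum_(i in [set: nat]) (a i)%:E = s%:E.
Proof.
move=> a0 aM; have h0 : 0 <= \esum_(i in [set: nat]) (a i)%:E.
  by apply: esum_ge0 => i _; rewrite lee_fin.
have : \esum_(i in [set: nat]) (a i)%:E <= M%:E.
  by apply: esum_nat_le => n; rewrite ?lee_fin// sumEFin lee_fin.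
by case: (\esum_(_ in _) _) h0 => [s|//|//]; rewrite lee_fin; exists s.
Qed.

Lemma esum_geometric (q : R) : (0 <= q < 1)%R ->
  \esum_(i in [set: nat]) (q ^+ i)%:E = (1 - q)^-1%:E.
Proof.
move=> q01; have /andP[q0 q1] := q01.
have qn n : (0 <= q ^+ n)%R by exact: exprn_ge0.
have [s s0 sE] := esum_fin qn (sum_geometric_le q01).
have : s%:E = 1 + q%:E * s%:E.
  rewrite -{1}sE esum_nat_recl ?expr0//; congr (_ + _); rewrite -sE -ge0_esumZl//.
  by apply: eq_esum => i _; rewrite exprS EFinM.
rewrite sE -EFinM -EFinD => -[sq]; congr (_%:E).
by apply: (mulIf (x := 1 - q)); [|rewrite mulVf]; [lra|nra|lra].
Qed.

Lemma esum_geometric_deriv (q : R) : (0 <= q < 1)%R ->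
  \esum_(i in [set: nat]) (i.+1%:R * q ^+ i)%:E = ((1 - q) ^+ 2)^-1%:E.
Proof.
move=> q01; have /andP[q0 q1] := q01.
have qn n : (0 <= q ^+ n)%R by exact: exprn_ge0.
have qn' n : (0 <= n.+1%:R * q ^+ n)%R by rewrite mulr_ge0.
have [s s0 sE] := esum_fin qn' (sum_geometric_deriv_le q01).
have : s%:E = (1 - q)^-1%:E + q%:E * s%:E.
  rewrite -(esum_geometric q01) -sE -ge0_esumZl//.
  rewrite [in LHS]esum_nat_recl// [X in _ = X + _]esum_nat_recl//.
  rewrite expr0 mul1r -addeA -esumD => [|i _|i _]; rewrite ?mule_ge0 ?lee_fin//.
  congr (_ + _); apply: eq_esum => i _.
  by rewrite -EFinM -EFinD exprS; congr (_%:E); rewrite -(natr1 i.+1); ring.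
rewrite sE -EFinM -EFinD => -[sq]; congr (_%:E).
have q1' : (1 - q != 0)%R by rewrite subr_eq0 eq_sym lt_eqF.
apply: (mulIf (x := (1 - q) ^+ 2)); first by rewrite expf_neq0.
rewrite mulVf ?expf_neq0//; apply/eqP; rewrite -subr_eq0; apply/eqP.
have -> : (s = (1 - q)^-1 + q * s)%R by [].
have e : ((1 - q) * s = (1 - q)^-1)%R by rewrite mulrBl mul1r {1}sq; ring.
by rewrite -sq expr2 mulrA -[(s * _)%R]mulrC e mulVf// subrr.
Qed.

End NonnegSums.

(** * Expectation against nonnegative weights *)

Section Expectation.
Context {R : realType}.
Local Open Scope ereal_scope.

Definition nn (A : Type) (f : A -> \bar R) := forall x, 0 <= f x.

(** Unlike in [Ex], the integrand takes values in the extended reals, so that an inner expectation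
    or an infinite sum can itself be integrated. It also serves for unnormalised weights such as
    [lam]. *)
Definition E (A : choiceType) (d : dist R A) (f : A -> \bar R) : \bar R :=
  \esum_(x in [set: A]) d x * f x.

Definition dsum (A : choiceType) (d : nat -> dist R A) : dist R A :=
  fun x => \esum_(j in [set: nat]) d j x.

Implicit Types A B : choiceType.

Lemma E_ge0 A (d : dist R A) f : nn d -> nn f -> 0 <= E d f.
Proof. by move=> d0 f0; apply: esum_ge0 => x _; exact: mule_ge0. Qed.

Lemma eq_E A (d : dist R A) f g : (forall x, f x = g x) -> E d f = E d g.
Proof. by move=> fg; apply: eq_esum => x _; rewrite fg. Qed.

Lemma le_E A (d : dist R A) f g : nn d -> (forall x, f x <= g x) -> E d f <= E d g.
Proof. by move=> d0 fg; apply: le_esum => x _; exact: lee_wpmul2l. Qed.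

Lemma E0 A (d : dist R A) : E d (fun=> 0) = 0.
Proof. by apply: esum1 => x _; rewrite mule0. Qed.

Lemma ED A (d : dist R A) f g : nn d -> nn f -> nn g ->
  E d (fun x => f x + g x) = E d f + E d g.
Proof.
move=> d0 f0 g0; rewrite -esumD; [|by move=> x _; exact: mule_ge0..].
by apply: eq_esum => x _; rewrite ge0_muleDr.
Qed.

Lemma EZ A (d : dist R A) c f : nn d -> nn f -> 0 <= c ->
  E d (fun x => c * f x) = c * E d f.
Proof.
move=> d0 f0 c0; rewrite -ge0_esumZl//; last by move=> x; exact: mule_ge0.
by apply: eq_esum => x _; rewrite muleCA.
Qed.

Lemma EZr A (d : dist R A) c f : nn d -> nn f -> 0 <= c ->
  E d (fun x => f x * c) = E d f * c.
Proof.
by move=> d0 f0 c0; rewrite muleC -EZ//; apply: eq_E => x; rewrite muleC.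
Qed.

Lemma E_esum A (T : choiceType) (d : dist R A) (f : A -> T -> \bar R) :
  nn d -> (forall x, nn (f x)) ->
  E d (fun x => \esum_(j in [set: T]) f x j) =
  \esum_(j in [set: T]) E d (fun x => f x j).
Proof.
move=> d0 f0; rewrite [RHS]exchange_esum; last by move=> j x; exact: mule_ge0 (d0 x) (f0 x j).
by apply: eq_esum => x _; rewrite ge0_esumZl//; exact: f0.
Qed.

Lemma nn_dret A (a : A) : nn (dret a : dist R A).
Proof. by move=> x; rewrite /dret; case: ifP. Qed.

Lemma nn_dbind A B (d : dist R A) (g : A -> dist R B) :
  nn d -> (forall x, nn (g x)) -> nn (dbind d g).
Proof. by move=> d0 g0 y; apply: esum_ge0 => x _; apply: mule_ge0 => //; exact: g0. Qed.

Lemma nn_dsum A (d : nat -> dist R A) : (forall j, nn (d j)) -> nn (dsum d).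
Proof. by move=> d0 x; apply: esum_ge0 => j _; exact: d0. Qed.

Lemma nn_dflip (r : R) : (0 <= r <= 1)%R -> nn (dflip r).
Proof. by case/andP=> r0 r1 [] /=; rewrite lee_fin ?subr_ge0. Qed.

Lemma nn_dgeom (r : R) : (0 <= r <= 1)%R -> nn (dgeom r).
Proof.
by case/andP=> r0 r1 j; rewrite lee_fin mulr_ge0 ?subr_ge0// exprn_ge0.
Qed.

Lemma E_dret A (a : A) (f : A -> \bar R) : nn f -> E (dret a) f = f a.
Proof.
move=> f0; rewrite /E (esum_single (t := a)) /dret ?eqxx ?mul1e//.
by move=> s /negPf ->; rewrite mul0e.
Qed.

Lemma E_dzero A (f : A -> \bar R) : E dzero f = 0.
Proof. by apply: esum1 => x _; rewrite mul0e. Qed.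

Lemma E_dbind A B (d : dist R A) (g : A -> dist R B) f :
  nn d -> (forall x, nn (g x)) -> nn f ->
  E (dbind d g) f = E d (fun x => E (g x) f).
Proof.
move=> d0 g0 f0; transitivity
  (\esum_(y in [set: B]) \esum_(x in [set: A]) (d x * g x y * f y)).
  apply: eq_esum => y _; rewrite ge0_esumZr// => x; exact: mule_ge0 (d0 x) (g0 x y).
rewrite exchange_esum; last first.
  by move=> y x; exact: mule_ge0 (mule_ge0 (d0 x) (g0 x y)) (f0 y).
apply: eq_esum => x _; rewrite -ge0_esumZl//; last first.
  by move=> y; exact: mule_ge0 (g0 x y) (f0 y).
by apply: eq_esum => y _; rewrite muleA.
Qed.

Lemma E_dsum A (d : nat -> dist R A) f : (forall j, nn (d j)) -> nn f ->
  E (dsum d) f = \esum_(j in [set: nat]) E (d j) f.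
Proof.
move=> d0 f0; rewrite [RHS]exchange_esum; last by move=> j x; exact: mule_ge0 (d0 j x) (f0 x).
by apply: eq_esum => x _; rewrite ge0_esumZr// => j; exact: d0.
Qed.

Lemma E_dflip (r : R) (f : bool -> \bar R) : (0 <= r <= 1)%R -> nn f ->
  E (dflip r) f = r%:E * f true + (1 - r)%:E * f false.
Proof.
move=> r01 f0; have d0 := nn_dflip r01; rewrite /E (esumID [set true]).
  rewrite setTI esum_set1; last exact: mule_ge0 (d0 true) (f0 true).
  congr (_ + _); rewrite (_ : _ `&` _ = [set false]).
    by rewrite esum_set1//; exact: mule_ge0 (d0 false) (f0 false).
  by rewrite setTI; apply/seteqP; split=> [[] /= h|b -> //]; [case: h|].
by move=> b _; exact: mule_ge0 (d0 b) (f0 b).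
Qed.

Lemma E_dgeom (r : R) (f : nat -> \bar R) :
  E (dgeom r) f = \esum_(j in [set: nat]) ((1 - r) * r ^+ j)%:E * f j.
Proof. by []. Qed.

End Expectation.

(** * Trace equivalence, maximal letters, cutting at a letter, normal forms *)

Section Words.
Variable Rel : rel nat.
Hypotheses (Rel_refl : reflexive Rel) (Rel_sym : symmetric Rel).

Local Notation "x ~~~ y" := (tr_eq Rel x y) (at level 70).
Local Notation indep a := (all (fun b => ~~ Rel a b)).

Lemma tr_refl x : x ~~~ x. Proof. exact: Relation_Operators.rt_refl. Qed.
Hint Resolve tr_refl : core.

Lemma tr_trans y x z : x ~~~ y -> y ~~~ z -> x ~~~ z.
Proof. exact: Relation_Operators.rt_trans. Qed.

Lemma tr_sym x y : x ~~~ y -> y ~~~ x.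
Proof.
elim=> [u v [s [t [a [b [ab [-> ->]]]]]]|//|u v w _ vu _ wv].
  by apply: Relation_Operators.rt_step; exists s, t, b, a; rewrite Rel_sym.
exact: tr_trans wv vu.
Qed.

Lemma tr_cat x y u v : x ~~~ y -> u ~~~ v -> x ++ u ~~~ y ++ v.
Proof.
move=> xy uv; apply: (@tr_trans (y ++ u)).
  elim: xy => [{}x {}y [s [t [a [b [ab [-> ->]]]]]]|//|x1 x2 x3 _ + _].
    apply: Relation_Operators.rt_step; exists s, (t ++ u), a, b.
    by rewrite -!catA.
  exact: tr_trans.
elim: uv => [{}u {}v [s [t [a [b [ab [-> ->]]]]]]|//|x1 x2 x3 _ + _].
  apply: Relation_Operators.rt_step; exists (y ++ s), t, a, b.
  by rewrite -!catA.
exact: tr_trans.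
Qed.

Lemma tr_cons a x y : x ~~~ y -> a :: x ~~~ a :: y.
Proof. exact: (@tr_cat [:: a] [:: a]). Qed.

Lemma tr_move a x : indep a x -> a :: x ~~~ rcons x a.
Proof.
elim: x => [//|b x IH] /= /andP[ab ax]; apply: (@tr_trans (b :: a :: x)).
  by apply: Relation_Operators.rt_step; exists [::], x, a, b.
exact: tr_cons (IH ax).
Qed.

Lemma tr_perm x y : x ~~~ y -> perm_eq x y.
Proof.
elim=> [u v [s [t [a [b [ab [-> ->]]]]]]|//|u v w _ uv _ vw].
  by rewrite perm_cat2l; apply/permPl; exact: (perm_catCA [:: a] [:: b] t).
exact: perm_trans uv vw.
Qed.

Lemma tr_all (P : pred nat) x y : x ~~~ y -> all P x = all P y.
Proof. by move/tr_perm/perm_all. Qed.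

(** Decides [maxl] by inspecting a single word of the class: some occurrence of the letter must
    commute with everything that follows it. *)
Fixpoint is_max (x : seq nat) (a : nat) : bool :=
  if x is b :: x' then is_max x' a || ((a == b) && indep a x') else false.

Lemma is_max_cat x y a :
  is_max (x ++ y) a = is_max y a || (is_max x a && indep a y).
Proof.
elim: x => [|b x IH] /=; first by rewrite orbF.
by rewrite IH all_cat andb_orl -orbA andbA.
Qed.

Lemma is_max_mem x a : is_max x a -> a \in x.
Proof.
elim: x => //= b x IH /orP[/IH|/andP[/eqP ->]]; rewrite inE ?eqxx// => ->.
by rewrite orbT.
Qed.

Lemma is_max_tr x y a : x ~~~ y -> is_max x a = is_max y a.
Proof.
elim=> [u v [s [t [b [c [bc [-> ->]]]]]]|//|u v w _ + _ <-//].
rewrite !is_max_cat /=; congr (_ || (_ && _)); last by do !bool_congr.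
rewrite -!orbA; congr (_ || _); rewrite orbC.
have cb : ~~ Rel c b by rewrite Rel_sym.
congr (_ || _); [have [->|//] := eqVneq a b | have [->|//] := eqVneq a c].
  by rewrite bc.
by rewrite cb.
Qed.

Lemma maxlP x a : maxl Rel x a <-> is_max x a.
Proof.
split=> [[y /is_max_tr ->]|]; first by rewrite -cats1 is_max_cat /= eqxx.
elim: x => //= b x IH /orP[/IH [y xy]|/andP[/eqP -> bx]].
  by exists (b :: y); rewrite rcons_cons; exact: tr_cons.
by exists x; exact: tr_move.
Qed.

(** Take the last letter of [x] that lies in [C]: what follows it is outside [C], hence commutes
    with it because [C] is closed under dependence. *)
Lemma closed_is_max (C : pred nat) (x : seq nat) :
  (forall a b, b \in x -> C a -> Rel a b -> C b) ->
  has C x -> exists2 b, is_max x b & C b.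
Proof.
elim: x => //= a x IH closed; have [Cx _|Cx /=] := boolP (has C x).
  have [|c cmax Cc] := IH _ Cx; last by exists c; rewrite ?cmax.
  by move=> b c cx; apply: closed; rewrite inE cx orbT.
rewrite orbF => Ca; exists a => //; rewrite eqxx /=; apply/orP; right.
apply/allP => b bx; apply/negP => ab; move/hasPn/(_ b bx)/negP: Cx; apply.
by apply: closed Ca ab; rewrite inE bx orbT.
Qed.

Section Split.
Variable a : nat.

(** Effect of a new leftmost letter [b] on a pair (letters below the first [a], remaining letters):
    [b] is below [a] when it depends on [a] or on a letter already below; otherwise it commutes past
    all of them. *)
Definition absorb (b : nat) (p : seq nat * seq nat) :=
  if Rel a b || has (Rel b) p.1 then (b :: p.1, p.2) else (p.1, b :: p.2).

(* The letters of [x] lying below its first [a] in the trace order, and all the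
   other ones except that [a]; meaningful only when [a \in x]. *)
Fixpoint below (x : seq nat) : seq nat * seq nat :=
  if x is b :: x' then
    if b == a then ([::], x') else absorb b (below x')
  else ([::], [::]).

Definition pair_eq (p q : seq nat * seq nat) := p.1 ~~~ q.1 /\ p.2 ~~~ q.2.

Lemma absorb_eq b p q : pair_eq p q -> pair_eq (absorb b p) (absorb b q).
Proof.
move=> [pq1 pq2]; rewrite /absorb (perm_has _ (tr_perm pq1)).
by case: ifP => _; split=> //=; [exact: (tr_cons b pq1)|exact: (tr_cons b pq2)].
Qed.

Lemma absorbC b c p : ~~ Rel b c -> pair_eq (absorb b (absorb c p)) (absorb c (absorb b p)).
Proof.
move=> bc; have cb : ~~ Rel c b by rewrite Rel_sym.
have swap x : b :: c :: x ~~~ c :: b :: x.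
  by apply: Relation_Operators.rt_step; exists [::], x, b, c.
rewrite /absorb; case Eb : (Rel a b || has (Rel b) p.1);
  case Ec : (Rel a c || has (Rel c) p.1) => /=;
  by rewrite ?(negPf bc) ?(negPf cb) /= ?Eb ?Ec /=; split=> //=; exact: swap.
Qed.

Lemma below_step x y : tr_step Rel x y -> pair_eq (below x) (below y).
Proof.
move=> [s [t [b [c [bc [-> ->]]]]]]; elim: s => [|d s IH] /=; last first.
  case: ifP => _; last exact: absorb_eq.
  by split=> //=; apply: Relation_Operators.rt_step; exists s, t, b, c.
(* By reflexivity the two swapped letters are not both [a]. If one of them is, the other commutes
   with [a] and enters the second component on both sides. *)
have [bE|ba] := eqVneq b a; have [cE|ca] := eqVneq c a.
- by move: bc; rewrite bE cE Rel_refl.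
- rewrite /absorb /= orbF; rewrite bE in bc; rewrite (negPf bc) /=; split=> //.
- rewrite /absorb /= orbF; rewrite cE Rel_sym in bc; rewrite (negPf bc) /=; split=> //.
- exact: absorbC.
Qed.

(** Uniqueness half of the factorization: the cut depends on the trace only, up to equivalence of
    its two parts. *)
Lemma below_tr x y : x ~~~ y -> pair_eq (below x) (below y).
Proof.
elim=> [u v /below_step//|u|u v w _ [uv1 uv2] _ [vw1 vw2]]; first by split.
by split; [exact: tr_trans uv1 vw1|exact: tr_trans uv2 vw2].
Qed.

(** Existence half: a letter that [absorb] does not keep commutes with [a] and with everything kept
    so far, so [tr_move] carries it to the right of [a]. *)
Lemma below_eq x : a \in x -> x ~~~ (below x).1 ++ a :: (below x).2.
Proof.
elim: x => //= b x IH; rewrite inE eq_sym; have [-> //|_ /= /IH] := eqVneq b a.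
rewrite /absorb; case: ifP => [_|/negbT]; first by move=> /(tr_cons b).
rewrite negb_or => /andP[ab bD] xE; apply: (tr_trans (tr_cons b xE)).
have := @tr_move b ((below x).1 ++ [:: a]); rewrite all_cat /= andbT.
rewrite (Rel_sym b a) ab andbT -all_predC in bD * => /(_ bD) mv.
have := tr_cat mv (tr_refl (below x).2).
by rewrite /= -catA cat1s -cats1 -!catA !cat1s.
Qed.

Lemma notin_below1 x : a \notin (below x).1.
Proof.
elim: x => //= b x IH; case: ifP => //= /negbT ba.
by rewrite /absorb; case: ifP => //= _; rewrite inE negb_or eq_sym ba.
Qed.

Lemma below_all (P : pred nat) x : all P x ->
  all P (below x).1 && all P (below x).2.
Proof.
elim: x => //= b x IH /andP[Pb Px]; case: ifP => //= _.
by case/andP: (IH Px) => P1 P2; rewrite /absorb; case: ifP => _ /=; rewrite Pb P1 P2.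
Qed.

Lemma is_max_below1 x b : is_max (below x).1 b -> Rel a b.
Proof.
elim: x => //= c x IH; case: ifP => //= _; rewrite /absorb; case: ifP => //= h.
case/orP=> [/IH//|/andP[/eqP -> /allP cD]]; case/orP: h => // /hasP[d dD cd].
by move/negP: (cD d dD); case.
Qed.

(** Every letter of [v] is kept: either a later letter of [v] depends on it, or it is maximal in [v]
    and then depends on [a] by assumption. *)
Lemma below_cat v x : a \notin v -> {in v, forall b, is_max v b -> Rel a b} ->
  below (v ++ a :: x) = (v, x).
Proof.
elim: v => [|b v IH] /=; first by rewrite eqxx.
rewrite inE negb_or eq_sym => /andP[/negPf -> av] vmax.
rewrite IH// => [|c cv cmax]; last by apply: vmax; rewrite ?inE ?cv ?orbT ?cmax.
rewrite /absorb ifT//=; have [//|bv] := boolP (has (Rel b) v); first by rewrite orbT.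
by rewrite vmax ?inE ?eqxx //= -[indep b v]/(all (predC (Rel b)) v) all_predC bv orbT.
Qed.

Lemma size_below x : a \in x -> size x = (size (below x).1 + (size (below x).2).+1)%N.
Proof. by move=> ax; rewrite (perm_size (tr_perm (below_eq ax))) size_cat. Qed.

End Split.

Lemma lexle_refl : reflexive lexle.
Proof. by elim=> //= a x ->; rewrite eqxx orbT. Qed.

Lemma lexle_trans : transitive lexle.
Proof.
elim=> [[]//|b y IH] [|a x] [|c z] //=.
move=> /orP[ab|/andP[/eqP ab xy]] /orP[bc|/andP[/eqP bc yz]]; apply/orP.
- by left; exact: ltn_trans ab bc.
- by left; rewrite -bc.
- by left; rewrite ab.
by right; rewrite ab bc eqxx (IH x).
Qed.

Lemma lexle_total : total lexle.
Proof.
elim=> [[]//|a x IH] [|b y] //=.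
by case: (ltngtP a b) => //= ->; rewrite eqxx /=.
Qed.

Lemma lexle_anti : antisymmetric lexle.
Proof.
elim=> [|a x IH] [|b y] //=; case: (ltngtP a b) => //= ->.
by move=> /IH ->.
Qed.

(** Equivalent words are permutations of each other, so a class is finite and has a least element
    for the total order [lexle]. *)
Lemma tr_nf_exists x : exists2 y, tr_nf Rel y & x ~~~ y.
Proof.
pose s := [seq y <- permutations x | `[< x ~~~ y >]].
have sP y : x ~~~ y <-> y \in s.
  rewrite mem_filter mem_permutations; split=> [xy|/andP[/asboolP//]].
  by rewrite asboolT// perm_sym tr_perm.
have [y ys ymin] : exists2 y, y \in s & {in s, forall z, lexle y z}.
  have : s != [::] by apply/eqP => s0; have := (sP x).1 (tr_refl x); rewrite s0.
  elim: s {sP} => // y [|z s] IH _.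
    by exists y; rewrite ?inE// => z; rewrite inE => /eqP ->; exact: lexle_refl.
  have [//|u us umin] := IH.
  have [yu|uy] := orP (lexle_total y u).
    exists y; rewrite ?inE ?eqxx// => v; rewrite inE => /orP[/eqP ->|/umin].
      exact: lexle_refl.
    exact: lexle_trans.
  exists u; rewrite ?inE; first by rewrite -in_cons us orbT.
  by move=> v; rewrite inE => /orP[/eqP ->//|]; exact: umin.
exists y; last exact/sP.
by move=> z yz; apply: ymin; apply/sP; apply: tr_trans yz; apply/sP.
Qed.

Lemma tr_nf_unique x y z : tr_nf Rel y -> tr_nf Rel z -> x ~~~ y -> x ~~~ z -> y = z.
Proof.
move=> nfy nfz xy xz; apply: lexle_anti; rewrite nfy ?nfz//.
  exact: tr_trans (tr_sym xz) xy.
exact: tr_trans (tr_sym xy) xz.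
Qed.

End Words.

(** * Recursion for clique polynomials *)

Section CliquePolynomials.
Variable Rel : rel nat.

Definition cliques k (P : pred nat) : pred {set 'I_k} :=
  fun A => [forall a in A, P (val a)] && is_clique Rel A.

Lemma cliquesP k (P : pred nat) (A : {set 'I_k}) :
  reflect ({in A, forall a : 'I_k, P (val a)} /\ {in A &, forall a b : 'I_k, a != b -> ~~ Rel a b})
          (cliques P A).
Proof.
apply: (iffP andP) => -[h1 h2]; split.
- by move=> a aA; move/forall_inP: h1 => /(_ a aA).
- move=> a b aA bA ab; move/forall_inP/(_ a aA)/forall_inP/(_ b bA): h2.
  by rewrite ab.
- by apply/forall_inP => a; exact: h1.
- by do 2![apply/forall_inP => ? ?]; apply/implyP; exact: h2.
Qed.

Lemma mu_polyE (F : nzRingType) k (P : pred nat) :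
  @mu_poly Rel F k P = \sum_(A : {set 'I_k} | cliques P A) (-1) ^+ #|A| *: 'X^#|A|.
Proof. by []. Qed.

Lemma eq_mu_poly (F : nzRingType) k (P Q : pred nat) :
  (forall i, (i < k)%N -> P i = Q i) -> @mu_poly Rel F k P = mu_poly Rel F k Q.
Proof.
move=> PQ; apply: eq_bigl => A; congr (_ && _).
by apply: eq_forallb => a; rewrite PQ ?ltn_ord.
Qed.

Lemma mu_poly_notin (F : nzRingType) k (P : pred nat) :
  ~~ P k -> @mu_poly Rel F k.+1 P = mu_poly Rel F k P.
Proof.
move=> Pk; pose w := widen_ord (leqnSn k).
have w_inj : injective w by move=> i j /(congr1 val) ij; exact: val_inj.
have wK (B : {set 'I_k}) : w @^-1: (w @: B) = B.
  by apply/setP => i; rewrite inE mem_imset.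
rewrite !mu_polyE (reindex_onto (fun B : {set 'I_k} => w @: B) (fun A => w @^-1: A)) /=.
  apply: eq_big => [B|B _]; last by rewrite card_imset.
  rewrite wK eqxx andbT; apply/cliquesP/cliquesP => -[h1 h2]; split.
  - by move=> i iB; exact: (h1 (w i) (imset_f _ iB)).
  - by move=> i j iB jB ij; apply: (h2 (w i) (w j)); rewrite ?imset_f ?(inj_eq w_inj).
  - by move=> _ /imsetP[i iB ->]; exact: h1.
  - by move=> _ _ /imsetP[i iB ->] /imsetP[j jB ->]; rewrite (inj_eq w_inj); exact: h2.
move=> A /cliquesP[AP _]; apply/setP => i; apply/imsetP/idP => [[j]|iA].
  by rewrite inE => jA ->.
have ik : (i < k)%N.
  rewrite ltn_neqAle -ltnS ltn_ord andbT; apply: contra Pk => /eqP <-; exact: AP.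
exists (Ordinal ik); last exact/val_inj.
by rewrite inE (_ : w _ = i)//; exact/val_inj.
Qed.

Hypotheses (Rel_refl : reflexive Rel) (Rel_sym : symmetric Rel).

(** A clique either avoids [a], or is [a] together with a clique of letters that commute with [a];
    the extra letter accounts for the factor -X. *)
Lemma mu_poly_remove (F : comNzRingType) k (P : pred nat) (a : 'I_k) : P a ->
  @mu_poly Rel F k P = mu_poly Rel F k [pred x | P x && (x != a)]
    - 'X * mu_poly Rel F k [pred x | P x && ~~ Rel a x].
Proof.
move=> Pa; rewrite !mu_polyE (bigID (fun A : {set 'I_k} => a \notin A)) /=.
congr (_ + _).
  apply: eq_bigl => A; apply/andP/cliquesP.
    move=> [/cliquesP[h1 h2] aA]; split=> // i iA /=; rewrite h1//=.
    by apply: contra aA => /eqP/val_inj <-.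
  move=> [h1 h2]; split; last by apply/negP => aA; have := h1 a aA; rewrite /= eqxx andbF.
  by apply/cliquesP; split=> // i /h1 /andP[].
rewrite (reindex_onto (fun B => a |: B) (fun A => A :\ a)) /=; last first.
  by move=> A /andP[_]; rewrite negbK => aA; exact: finset.setD1K.
rewrite mulr_sumr -sumrN; apply: eq_big => [B|B] /=.
  rewrite negbK finset.setU11 andbT; apply/andP/cliquesP.
    move=> [/cliquesP[h1 h2] /eqP Ba].
    have aB : a \notin B by rewrite -Ba !inE eqxx.
    split=> [i iB /=|i j iB jB]; last by apply: h2; rewrite inE ?iB ?jB orbT.
    rewrite h1 ?inE ?iB ?orbT//=; apply: h2; rewrite ?inE ?eqxx ?iB ?orbT//.
    by apply: contraNneq aB => ->.
  move=> [h1 h2].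
  have aB : a \notin B by apply/negP => aB; have := h1 a aB; rewrite /= Rel_refl andbF.
  split; last by rewrite finset.setU1K.
  have aR i : i \in B -> ~~ Rel a i by case/h1/andP.
  apply/cliquesP; split=> [i|i j]; rewrite !inE.
    by case/orP=> [/eqP ->//|/h1 /andP[]].
  case/orP=> [/eqP ->|iB] /orP[/eqP ->|jB]; rewrite ?eqxx//.
  - by move=> _; exact: aR.
  - by move=> _; rewrite Rel_sym aR.
  - exact: h2.
rewrite negbK finset.setU11 andbT => /andP[_ /eqP Ba].
have aB : a \notin B by rewrite -Ba !inE eqxx.
by rewrite cardsU1 aB add1n !exprS mulN1r scaleNr scalerAr.
Qed.

Lemma mu_polyS (F : comNzRingType) k (P : pred nat) : P k ->
  @mu_poly Rel F k.+1 P =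
  mu_poly Rel F k P - 'X * mu_poly Rel F k [pred x | P x && ~~ Rel k x].
Proof.
move=> Pk; rewrite (@mu_poly_remove F k.+1 P ord_max)//=.
rewrite !mu_poly_notin /= ?eqxx ?andbF ?Rel_refl ?andbF//; congr (_ - _).
by apply: eq_mu_poly => i ik /=; rewrite ltn_eqF// andbT.
Qed.

Lemma mu_poly0 (F : nzRingType) (P : pred nat) : @mu_poly Rel F 0 P = 1.
Proof.
rewrite mu_polyE (big_pred1 finset.set0) => [|A]; first by rewrite cards0 expr0 scale1r expr0.
apply/cliquesP/eqP => [_|->]; last by split=> [i|i j]; rewrite inE.
by apply/setP => i; have := ltn_ord i; rewrite ltn0.
Qed.

Lemma map_mu_poly (F G : nzRingType) (f : {rmorphism F -> G}) k P :
  map_poly f (@mu_poly Rel F k P) = mu_poly Rel G k P.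
Proof.
rewrite rmorph_sum; apply: eq_bigr => A _ /=.
by rewrite map_polyZ map_polyXn rmorphXn rmorphN1.
Qed.

End CliquePolynomials.

(** * Positivity of clique polynomials below the smallest root *)

Section Positivity.
Variable R : rcfType.

(** Positivity is propagated on the whole interval because the passage to subsets looks at a first
    root, which lies somewhere before [t]. *)
Definition pos_upto (f : {poly R}) (t : R) := forall s, 0 <= s <= t -> 0 < f.[s].

Lemma no_root_pos (f : {poly R}) t : 0 < f.[0] ->
  (forall s, 0 <= s <= t -> ~~ root f s) -> pos_upto f t.
Proof.
move=> f0 nr s st; rewrite ltNge; apply/negP => fs.
have /andP[s0 s1] := st.
have [|x] := @polyrcf.poly_ivt _ f 0 s s0; first by rewrite pmulr_rle0.
rewrite in_itv /= => /andP[x0 xs]; apply/negP/nr.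
by rewrite x0 (le_trans xs).
Qed.

Lemma first_root (f : {poly R}) t : 0 < f.[0] -> ~ pos_upto f t ->
  exists q, [/\ 0 < q <= t, f.[q] = 0 & forall s, 0 <= s < q -> pos_upto f s].
Proof.
move=> f0 npos; have [s s0 fs] : exists2 s, 0 <= s <= t & root f s.
  have [//|/existsNP[s /not_implyP[st /negP]]] :=
    pselect (forall s, 0 <= s <= t -> ~~ root f s).
    by move/(no_root_pos f0).
  by rewrite negbK; exists s.
have sgt0 : 0 < s.
  by rewrite lt_def (andP s0).1 andbT; apply: contraTneq fs => ->; rewrite rootE gt_eqF.
have fn0 : f != 0 by apply: contraTneq f0 => ->; rewrite horner0 ltxx.
(* The open interval ends at [t + 1] so that a root at [t] itself is still found. *)
have sin : s \in Interval (BRight 0) (BLeft (t + 1)) by rewrite in_itv /= sgt0; lra.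
case: (next_rootP f 0 (t + 1)) => [f00|y _ fy y0 ny|c _ _ nr].
- by rewrite f00 eqxx in fn0.
- exists y; split=> //.
    move: y0; rewrite in_itv /= => /andP[-> yt]; rewrite leNgt; apply/negP => ty.
    have : s \in Interval (BRight 0) (BLeft y) by rewrite in_itv /= sgt0; lra.
    by move/ny; rewrite fs.
  move=> u /andP[u0 uy]; apply: no_root_pos => // v /andP[v0 vu].
  have [->|vn0] := eqVneq v 0; first by rewrite rootE gt_eqF.
  by apply: ny; rewrite in_itv /= lt_def vn0 v0 (le_lt_trans vu).
- by have := nr s sin; rewrite fs.
Qed.

Lemma pos_closure (g : {poly R}) q : 0 < q ->
  (forall s, 0 <= s < q -> 0 < g.[s]) -> 0 <= g.[q].
Proof.
move=> q0 gpos; rewrite leNgt; apply/negP => gq.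
have [|x] := @poly_ivtoo _ g 0 q (ltW q0).
  by rewrite pmulr_rlt0// gpos ?lexx.
rewrite in_itv /= => /andP[x0 xq]; apply/negP; rewrite rootE gt_eqF// gpos//.
by rewrite ltW.
Qed.

Variable Rel : rel nat.
Hypotheses (Rel_refl : reflexive Rel) (Rel_sym : symmetric Rel).
Local Notation mup k P := (@mu_poly Rel R k P).

Lemma mu_poly_at0 k (P : pred nat) : (mup k P).[0] = 1.
Proof.
elim: k P => [|k IH] P; first by rewrite mu_poly0 hornerE.
have [Pk|Pk] := boolP (P k); last by rewrite mu_poly_notin.
by rewrite mu_polyS// hornerD hornerN hornerM hornerX mul0r subr0.
Qed.

(** This is the monotonicity of p_S, by removing one letter a. If mu_{P \ a} first vanished at q <=
    t, then mu_{P \ L(a)}, whose alphabet lies inside P \ a, would be positive before q by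
    induction, hence nonnegative at q; then mu_P(q) = - q mu_{P \ L(a)}(q) <= 0, against the
    assumption. *)
Lemma mu_poly_pos_sub k (P Q : pred nat) t : (forall i, (i < k)%N -> Q i -> P i) ->
  pos_upto (mup k P) t -> pos_upto (mup k Q) t.
Proof.
have [n] := ubnP #|[pred i : 'I_k | P i]|; elim: n P Q t => // n IH P Q t Pn QP Pt.
have [/existsP[a /andP[Pa Qa]]|] := boolP [exists a : 'I_k, P a && ~~ Q a]; last first.
  rewrite negb_exists => /forallP PQ.
  rewrite (@eq_mu_poly _ _ _ Q P)// => i ik; apply/idP/idP; first exact: QP.
  by move=> Pi; have := PQ (Ordinal ik); rewrite /= Pi negbK.
pose Pa' := [pred x | P x && (x != a :> nat)].
have card : (#|[pred i : 'I_k | Pa' i]| < n)%N.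
  rewrite -ltnS (leq_trans _ Pn)// ltnS; apply: proper_card; apply/fintype.properP; split.
    by apply/fintype.subsetP => i; rewrite !inE => /andP[].
  by exists a; rewrite inE /= ?Pa ?eqxx ?andbF.
suff posa : pos_upto (mup k Pa') t.
  apply: (IH Pa') => // i ik Qi /=; rewrite QP//=.
  by apply: contraNneq Qa => <-.
have [//|] := pselect (pos_upto (mup k Pa') t).
move=> /first_root[|q [/andP[q0 qt] rq posq]]; first by rewrite mu_poly_at0.
have g0 : 0 <= (mup k [pred x | P x && ~~ Rel a x]).[q].
  apply: pos_closure => // s /andP[s0 sq].
  apply: (IH Pa' _ s) => //; last by rewrite s0 lexx.
    move=> i ik /= /andP[-> aix]; by apply: contraNneq aix => ->.
  by apply: posq; rewrite s0.
have := Pt q; rewrite (ltW q0) qt => /(_ isT).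
rewrite (mu_poly_remove Rel_refl Rel_sym _ Pa) !hornerE rq add0r oppr_gt0.
by rewrite pmulr_rlt0// ltNge g0.
Qed.

Lemma below_pS_pos k p : below_pS Rel k p -> pos_upto (mup k predT) p.
Proof.
move=> bp; apply: no_root_pos; first by rewrite mu_poly_at0.
move=> s /andP[s0 sp]; apply/negP => rs.
have := bp (real_complex R s); rewrite -(map_mu_poly _ (real_complex R)).
rewrite fmorph_root => /(_ rs); rewrite /ComplexField.Normc.normc /= expr0n addr0.
rewrite sqrtr_sqr ger0_norm//.
by rewrite ltNge sp.
Qed.

Lemma below_pS_mu_gt0 k p (P : pred nat) j : 0 < p -> below_pS Rel k p -> (j <= k)%N ->
  0 < (mup j P).[p].
Proof.
move=> p0 bp jk.
(* The polynomial over the first [j] letters is that of a subset of Sigma_k, so the comparison of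
   subsets applies to it. *)
suff <- : mup k [pred x | P x && (x < j)%N] = mup j P.
  apply: (@mu_poly_pos_sub k predT) (below_pS_pos bp) _ _ => //.
  by rewrite (ltW p0) lexx.
elim: k jk {bp} => [|k IH]; first by rewrite leqn0 => /eqP ->; rewrite !mu_poly0.
rewrite leq_eqVlt => /orP[/eqP ->|jk].
  by apply: eq_mu_poly => i ik /=; rewrite ik andbT.
by rewrite mu_poly_notin ?IH//= negb_and -leqNgt -ltnS jk orbT.
Qed.

End Positivity.

(** * The weighted set of factorized words *)

Section PyramidMeasure.
Variables (R : realType) (Rel : rel nat) (p : R).
Hypotheses (Rel_refl : reflexive Rel) (Rel_sym : symmetric Rel) (p_ge0 : 0 <= p).
Local Open Scope ereal_scope.

Definition dscale (A : choiceType) (c : \bar R) (d : dist R A) : dist R A :=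
  fun x => c * d x.

Definition dadd (A : choiceType) (d1 d2 : dist R A) : dist R A :=
  fun x => d1 x + d2 x.

Lemma E_dscale (A : choiceType) c (d : dist R A) f : 0 <= c -> nn d -> nn f ->
  E (dscale c d) f = c * E d f.
Proof.
move=> c0 d0 f0; rewrite -ge0_esumZl//; last by move=> x; exact: mule_ge0 (d0 x) (f0 x).
by apply: eq_esum => x _; rewrite muleA.
Qed.

Lemma E_dadd (A : choiceType) (d1 d2 : dist R A) f : nn d1 -> nn d2 -> nn f ->
  E (dadd d1 d2) f = E d1 f + E d2 f.
Proof.
move=> d10 d20 f0; rewrite -esumD; [|by move=> x _; exact: mule_ge0..].
by apply: eq_esum => x _; rewrite ge0_muleDl.
Qed.

Lemma nn_dzero (A : choiceType) : nn (dzero : dist R A).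
Proof. by []. Qed.

Lemma nn_dscale (A : choiceType) c (d : dist R A) : 0 <= c -> nn d -> nn (dscale c d).
Proof. by move=> c0 d0 x; exact: mule_ge0. Qed.

Lemma nn_dadd (A : choiceType) (d1 d2 : dist R A) : nn d1 -> nn d2 -> nn (dadd d1 d2).
Proof. by move=> d10 d20 x; exact: adde_ge0. Qed.

(** The weight p of each separating letter [a] is put in here; the letters between separators are
    weighted by [d]. *)
Fixpoint blocks (d : dist R (seq nat)) (a m : nat) : dist R (seq nat) :=
  if m is m'.+1 then
    dscale p%:E (dbind d (fun v => dbind (blocks d a m') (fun xs => dret (v ++ a :: xs))))
  else dret [::].

(** Written exactly as the until-test of the procedure for R = 1, so that [stop k l true v] is
    [accepts Rel k (Rel l.-1) v] by computation. *)
Definition accepts (k : nat) (T : pred nat) (v : seq nat) : bool :=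
  T k || ~~ all (fun x => (x < k)%N && ~~ Rel k x) v.

(* [lam k P T] weighs by [p ^ length] exactly one word for each trace over
   the letters [i < k] with [P i] whose maximal letters are all in [T]. *)
Fixpoint lam (k : nat) (P T : pred nat) : dist R (seq nat) :=
  if k is k'.+1 then
    dadd (lam k' P T)
      (if P k' then dsum (fun j => dbind (lam k' P T) (fun v =>
         if accepts k' T v then
           dbind (blocks (lam k' P (Rel k')) k' j.+1) (fun xs => dret (xs ++ v))
         else dzero)) else dzero)
  else dret [::].

Lemma nn_blocks d a m : nn d -> nn (blocks d a m).
Proof.
move=> d0; elim: m => [|m IH] /=; first exact: nn_dret.
apply: nn_dscale; first by rewrite lee_fin.
apply: nn_dbind => // v; apply: nn_dbind => // xs; exact: nn_dret.
Qed.

Lemma nn_lam_term k P T j v : (forall P T, nn (lam k P T)) ->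
  nn (if accepts k T v then
       dbind (blocks (lam k P (Rel k)) k j.+1) (fun xs => dret (xs ++ v))
      else dzero : dist R _).
Proof.
move=> IH; case: ifP => _; last exact: nn_dzero.
by apply: nn_dbind => [|xs]; [exact: nn_blocks|exact: nn_dret].
Qed.

Lemma nn_lam k P T : nn (lam k P T).
Proof.
elim: k P T => [|k IH] P T /=; first exact: nn_dret.
apply: nn_dadd => //; case: ifP => _; last exact: nn_dzero.
by apply: nn_dsum => j; apply: nn_dbind => // v; exact: nn_lam_term.
Qed.
Hint Resolve nn_lam nn_blocks : core.

Lemma E_blocks0 d a f : nn f -> E (blocks d a 0) f = f [::].
Proof. exact: E_dret. Qed.

Lemma E_blocksS d a m f : nn d -> nn f -> E (blocks d a m.+1) f =
  p%:E * E d (fun v => E (blocks d a m) (fun xs => f (v ++ a :: xs))).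
Proof.
move=> d0 f0; have nnr v : nn (dbind (blocks d a m) (fun xs => dret (v ++ a :: xs) : dist R _)).
  by apply: nn_dbind => [|xs]; [exact: nn_blocks|exact: nn_dret].
rewrite E_dscale ?lee_fin//; last exact: nn_dbind.
rewrite E_dbind//; congr (_ * _); apply: eq_E => v.
rewrite E_dbind//; [|exact: nn_blocks|by move=> xs; exact: nn_dret].
by apply: eq_E => xs; rewrite E_dret.
Qed.

Lemma E_lam0 P T f : nn f -> E (lam 0 P T) f = f [::].
Proof. exact: E_dret. Qed.

(** [j] counts the blocks after the first one. Words without the letter [k] form the other summand
    of [lam], to which the test [accepts] is not applied. *)
Definition lam_term k P T f j v :=
  if accepts k T v then E (blocks (lam k P (Rel k)) k j.+1) (fun xs => f (xs ++ v))
  else 0.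

Lemma lam_term_ge0 k P T f j v : nn f -> 0 <= lam_term k P T f j v.
Proof.
move=> f0; rewrite /lam_term; case: ifP => // _.
by apply: E_ge0 => [|xs]; [exact: nn_blocks|exact: f0].
Qed.

Lemma E_lamS k P T f : nn f -> E (lam k.+1 P T) f = E (lam k P T) f +
  (if P k then \esum_(j in [set: nat]) E (lam k P T) (lam_term k P T f j) else 0).
Proof.
move=> f0; have nnj j : nn (dbind (lam k P T) (fun v => if accepts k T v then
       dbind (blocks (lam k P (Rel k)) k j.+1) (fun xs => dret (xs ++ v))
      else dzero : dist R _)).
  by apply: nn_dbind => // v; apply: nn_lam_term.
rewrite E_dadd//; last by case: ifP => _; [exact: nn_dsum|exact: nn_dzero].
congr (_ + _); case: ifP => _; last exact: E_dzero.
rewrite E_dsum//; apply: eq_esum => j _; rewrite E_dbind//; last first.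
  by move=> v; apply: nn_lam_term.
apply: eq_E => v; rewrite /lam_term; case: ifP => _; last exact: E_dzero.
rewrite E_dbind//; [|exact: nn_blocks|by move=> xs; exact: nn_dret].
by apply: eq_E => xs; rewrite E_dret.
Qed.

(** Concentration of [d] on [S], phrased with expectations because this form goes through the
    recursion equations of [blocks] and [lam]. *)
Definition carried (d : dist R (seq nat)) (S : seq nat -> Prop) :=
  forall f g, nn f -> nn g -> (forall w, S w -> f w = g w) -> E d f = E d g.

Lemma carried_blocks d a (S S' : seq nat -> Prop) m : nn d -> carried d S ->
  S' [::] -> (forall v xs, S v -> S' xs -> S' (v ++ a :: xs)) ->
  carried (blocks d a m) S'.
Proof.
move=> d0 dS S0 SS; elim: m => [|m IH] f g f0 g0 fg; first by rewrite !E_blocks0// fg.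
rewrite !E_blocksS//; congr (_ * _); apply: dS => [v|v|v Sv].
- by apply: E_ge0; [exact: nn_blocks|move=> xs; exact: f0].
- by apply: E_ge0; [exact: nn_blocks|move=> xs; exact: g0].
by apply: IH => [xs|xs|xs Sxs]; [exact: f0|exact: g0|apply: fg; exact: SS].
Qed.

Definition lam_support k (P T : pred nat) (w : seq nat) :=
  [/\ all (fun i => (i < k)%N) w, all P w & forall b, is_max Rel w b -> T b].

(** A maximal letter of a factor [v] depends on [k], so the separator [k] placed after [v] prevents
    it from being maximal in the product. *)
Lemma carried_lam_blocks k P m : (forall T, carried (lam k P T) (lam_support k P T)) ->
  P k -> carried (blocks (lam k P (Rel k)) k m)
    (fun xs => [/\ all (fun i => (i < k.+1)%N) xs, all P xs &
                   forall b, is_max Rel xs b -> b = k]).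
Proof.
move=> IH Pk; apply: carried_blocks (IH _) _ _ => //.
move=> v xs [vk vP vmax] [xk xP xmax]; rewrite !all_cat /= ltnS leqnn Pk xk xP vP /= !andbT.
split=> //; first by apply: sub_all vk => i /= ik; exact: ltnW.
move=> b; rewrite is_max_cat /= => /orP[/orP[/xmax//|/andP[/eqP//]]|/and3P[/vmax kb bk _]].
by rewrite Rel_sym kb in bk.
Qed.

Lemma carried_lam k P T : carried (lam k P T) (lam_support k P T).
Proof.
elim: k P T => [|k IH] P T f g f0 g0 fg; first by rewrite !E_lam0// fg.
rewrite !E_lamS//; congr (_ + _).
  apply: (IH) => // w [wk wP wT]; apply: fg; split=> //.
  by apply: sub_all wk => i /= ik; exact: ltnW.
case: ifP => // Pk; apply: eq_esum => j _; apply: (IH) => [v|v|v [vk vP vT]].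
- exact: lam_term_ge0.
- exact: lam_term_ge0.
rewrite /lam_term; case: ifP => // acc.
apply: (carried_lam_blocks _ (fun T => IH P T) Pk) => [xs|xs|xs [xk xP xmax]].
- exact: f0.
- exact: g0.
apply: fg; split; rewrite ?all_cat ?xk ?xP ?vP ?andbT//.
  by apply: sub_all vk => i /= ik; exact: ltnW.
(* A maximal letter coming from the blocks is [k], and it commutes with all of [v]; [accepts] then
   forces [k] to be in [T]. *)
move=> b; rewrite is_max_cat => /orP[/vT//|/andP[/xmax -> kv]].
move: acc; rewrite /accepts => /orP[//|/negP[]].
by apply/allP => i iv; rewrite (allP vk)// (allP kv).
Qed.

Lemma E_blocks_filter k (P Q : pred nat) m (f : seq nat -> \bar R) : nn f -> Q k ->
  (forall (T : pred nat) f, nn f -> E (lam k P T) (fun w => if all Q w then f w else 0) =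
                       E (lam k (predI P Q) T) f) ->
  E (blocks (lam k P (Rel k)) k m) (fun w => if all Q w then f w else 0) =
  E (blocks (lam k (predI P Q) (Rel k)) k m) f.
Proof.
move=> + Qk IH; elim: m f => [|m IHm] f f0.
  by rewrite !E_blocks0// => w; case: ifP.
have f0' : nn (fun w => if all Q w then f w else 0) by move=> w; case: ifP.
rewrite !E_blocksS// -IH; last first.
  by move=> w; apply: E_ge0; [exact: nn_blocks|move=> xs; exact: f0].
congr (_ * _); apply: eq_E => v; case: ifP => Qv.
  rewrite -IHm; last by move=> xs; exact: f0.
  by apply: eq_E => xs; rewrite all_cat /= Qv Qk.
by rewrite -[RHS](E0 (blocks (lam k P (Rel k)) k m)); apply: eq_E => xs; rewrite all_cat Qv.
Qed.

(** The recursion treats each factor separately: a letter [k] outside [Q] kills every term with a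
    block, and otherwise the filter passes to the factors. Maximal letters and [accepts] are
    untouched, so only the alphabet shrinks. *)
Lemma E_lam_filter k (P T Q : pred nat) (f : seq nat -> \bar R) : nn f ->
  E (lam k P T) (fun w => if all Q w then f w else 0) = E (lam k (predI P Q) T) f.
Proof.
elim: k P T Q f => [|k IH] P T Q f f0; first by rewrite !E_lam0// => w; case: ifP.
have f0' : nn (fun w => if all Q w then f w else 0) by move=> w; case: ifP.
rewrite !E_lamS// IH// /=; congr (_ + _).
case: (boolP (P k)) => //= Pk; case: ifP => Qk; last first.
  apply: esum1 => j _; rewrite -[RHS](E0 (lam k P T)); apply: eq_E => v.
  rewrite /lam_term; case: ifP => // _; rewrite E_blocksS//.
  rewrite -[RHS](mule0 p%:E); congr (_ * _); rewrite -[RHS](E0 (lam k P (Rel k))).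
  apply: eq_E => v1; rewrite -[RHS](E0 (blocks (lam k P (Rel k)) k j)).
  by apply: eq_E => xs; rewrite -catA all_cat /= Qk andbF.
apply: eq_esum => j _; rewrite -IH; last by move=> v; exact: lam_term_ge0.
apply: eq_E => v; rewrite /lam_term; case: ifP => acc; case: ifP => Qv //.
  rewrite -(@E_blocks_filter k P Q j.+1 (fun xs => f (xs ++ v)))//.
    by apply: eq_E => xs; rewrite all_cat Qv andbT.
  by move=> T' f' f'0; exact: IH.
rewrite -[RHS](E0 (blocks (lam k P (Rel k)) k j.+1)); apply: eq_E => xs.
by rewrite all_cat Qv andbF.
Qed.

End PyramidMeasure.

(** * Total mass and total length in terms of clique polynomials *)

Section GeneratingFunctions.
Variables (R : realType) (Rel : rel nat) (p : R).
Hypotheses (Rel_refl : reflexive Rel) (Rel_sym : symmetric Rel) (p_gt0 : 0 < p).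
Variable K : nat.
Hypothesis mu_gt0 : forall k (P : pred nat), (k <= K)%N -> 0 < mu Rel p k P.
Local Open Scope ereal_scope.
Local Notation mu := (mu Rel p).
Local Notation mu' := (mu' Rel p).
Local Notation lam := (lam Rel p).
Local Notation minus P Q := (predI P (predC Q)).
Let p_ge0 := ltW p_gt0.
Let nnl k P T := @nn_lam R Rel p p_ge0 k P T.
Let nnb k P T a m := nn_blocks p_ge0 a m (nnl k P T).
Hint Resolve nnl nnb : core.

Lemma eq_mu k (P Q : pred nat) : (forall i, (i < k)%N -> P i = Q i) -> mu k P = mu k Q.
Proof. by move=> PQ; rewrite /Defs.mu (eq_mu_poly _ _ PQ). Qed.

Lemma eq_mu' k (P Q : pred nat) : (forall i, (i < k)%N -> P i = Q i) -> mu' k P = mu' k Q.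
Proof. by move=> PQ; rewrite /Defs.mu' (eq_mu_poly _ _ PQ). Qed.

Lemma mu_notin k (P : pred nat) : ~~ P k -> mu k.+1 P = mu k P.
Proof. by move=> Pk; rewrite /Defs.mu mu_poly_notin. Qed.

Lemma mu'_notin k (P : pred nat) : ~~ P k -> mu' k.+1 P = mu' k P.
Proof. by move=> Pk; rewrite /Defs.mu' mu_poly_notin. Qed.

Lemma muS k (P : pred nat) : P k -> (mu k.+1 P = mu k P - p * mu k (minus P (Rel k)))%R.
Proof. by move=> Pk; rewrite /Defs.mu mu_polyS// hornerD hornerN hornerM hornerX. Qed.

Lemma mu'S k (P : pred nat) : P k ->
  (mu' k.+1 P = mu' k P - mu k (minus P (Rel k)) - p * mu' k (minus P (Rel k)))%R.
Proof.
move=> Pk; rewrite /Defs.mu' /Defs.mu mu_polyS// derivB derivM derivX mul1r.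
by rewrite hornerD hornerN hornerD hornerM hornerX opprD addrA.
Qed.

Lemma mu0 (P : pred nat) : mu 0 P = 1%R.
Proof. by rewrite /Defs.mu mu_poly0 hornerE. Qed.

Lemma mu'0 (P : pred nat) : mu' 0 P = 0%R.
Proof. by rewrite /Defs.mu' mu_poly0 derivC hornerE. Qed.

(** When [k] is not in [T], the rejected words are those over the letters that commute with [k],
    which [E_lam_filter] identifies with [lam] over a smaller alphabet. The identity is additive so
    as not to subtract in the extended reals. *)
Lemma E_lam_accepts k (P T : pred nat) (f : seq nat -> \bar R) : nn f ->
  E (lam k P T) (fun v => if accepts Rel k T v then f v else 0) +
  (if T k then 0 else E (lam k (minus P (Rel k)) T) f) = E (lam k P T) f.
Proof.
move=> f0; case: ifP => Tk.
  by rewrite adde0; apply: eq_E => v; rewrite /accepts Tk.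
rewrite -E_lam_filter// -ED//; [|by move=> v; case: ifP..].
apply: carried_lam => // [v|v [vk _ _]].
  by apply: adde_ge0; case: ifP => // _; exact: f0.
rewrite /accepts Tk /=; rewrite (_ : all (fun x => (x < k)%N && _) v = all (predC (Rel k)) v).
  by case: (all _ v) => /=; rewrite ?adde0 ?add0e.
by apply: eq_in_all => x xv; rewrite (allP vk).
Qed.

Lemma fin_subtr (a : \bar R) (b c : R) : a + b%:E = c%:E -> a = (c - b)%:E.
Proof. by case: a => //= a [<-]; rewrite addrK. Qed.

(** The classical generating function, evaluated at p, of the traces over [P] with all maximal
    letters in [T]. *)
Definition mass k (P T : pred nat) : R := (mu k (minus P T) / mu k P)%R.

(** p times the derivative in p of [mass], that is the sum of |x| p^|x|; division by the mass comes
    later. *)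
Definition mean_size k (P T : pred nat) : R :=
  (p * (mu' k (minus P T) * mu k P - mu k (minus P T) * mu' k P) / mu k P ^+ 2)%R.

Lemma mass_ge0 k P T : (k <= K)%N -> (0 <= mass k P T)%R.
Proof. by move=> kK; rewrite divr_ge0 ?ltW ?mu_gt0. Qed.

Lemma E_cst k P T (c : R) : (0 <= c)%R ->
  E (lam k P T) (fun=> c%:E) = c%:E * E (lam k P T) (fun=> 1).
Proof. by move=> c0; rewrite -EZ ?lee_fin//; apply: eq_E => x; rewrite mule1. Qed.

Lemma E_blocks_mass k P T a m (q : R) : (0 <= q)%R -> E (lam k P T) (fun=> 1) = q%:E ->
  E (blocks p (lam k P T) a m) (fun=> 1) = ((p * q) ^+ m)%:E.
Proof.
move=> q0 Eq; elim: m => [|m IH]; first by rewrite E_blocks0.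
rewrite E_blocksS//; under eq_E do rewrite IH.
by rewrite E_cst ?Eq ?exprn_ge0 ?mulr_ge0// -!EFinM exprS; congr (_%:E); ring.
Qed.

(** One of the m blocks supplies its length, with weight p (q + s), the 1 in (|v| + 1) giving q; the
    m - 1 others supply their mass p q. For m = 0 the factor [m%:R] gives 0 whatever [m.-1] is. *)
Lemma E_blocks_size k P T a m (q s : R) : (0 <= q)%R -> (0 <= s)%R ->
  E (lam k P T) (fun=> 1) = q%:E ->
  E (lam k P T) (fun w => (size w)%:R%:E) = s%:E ->
  E (blocks p (lam k P T) a m) (fun xs => (size xs)%:R%:E) =
  (m%:R * (p * q) ^+ m.-1 * (p * (q + s)))%:E.
Proof.
move=> q0 s0 Eq Es; elim: m => [|m IH]; first by rewrite E_blocks0// !mul0r.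
have pq0 : (0 <= (p * q) ^+ m)%R by rewrite exprn_ge0// mulr_ge0.
rewrite E_blocksS//; transitivity (p%:E * E (lam k P T) (fun v =>
    ((p * q) ^+ m)%:E * (size v)%:R%:E +
    ((p * q) ^+ m + m%:R * (p * q) ^+ m.-1 * (p * (q + s)))%:E)).
  congr (_ * _); apply: eq_E => v.
  rewrite (eq_E _ (g := fun xs => ((size v).+1%:R)%:E * 1 + (size xs)%:R%:E)); last first.
    by move=> xs; rewrite mule1 -EFinD size_cat /= addnS -addSn natrD.
  rewrite ED ?EZ ?(E_blocks_mass _ _ q0 Eq) ?IH//.
  by rewrite -!EFinM -!EFinD -natr1; congr (_%:E); ring.
have c0 : (0 <= (p * q) ^+ m + m%:R * (p * q) ^+ m.-1 * (p * (q + s)))%R.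
  by rewrite addr_ge0// !mulr_ge0 ?exprn_ge0 ?mulr_ge0 ?addr_ge0.
rewrite ED//; last by move=> v; rewrite mule_ge0 ?lee_fin.
rewrite EZ ?lee_fin// (E_cst _ _ _ c0) Es Eq.
rewrite -!EFinM; congr (_%:E).
case: m {IH pq0 c0} => [|m] /=; first by rewrite !expr0; ring.
by rewrite exprS -(natr1 m.+1); ring.
Qed.

(** Closed form of [E_lam_accepts] after subtraction. Abstracting over [F] lets the same formula
    serve for [mass] and [mean_size]. *)
Definition accepted (F : nat -> pred nat -> pred nat -> R) k (P T : pred nat) : R :=
  (F k P T - (if T k then 0 else F k (minus P (Rel k)) T))%R.

Lemma E_lam_accepted k (f : seq nat -> \bar R) (F : nat -> pred nat -> pred nat -> R) P T :
  nn f -> (forall P T, E (lam k P T) f = (F k P T)%:E) ->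
  E (lam k P T) (fun v => if accepts Rel k T v then f v else 0) = (accepted F k P T)%:E.
Proof.
move=> f0 EF; apply: fin_subtr; rewrite -(EF P T) -(E_lam_accepts k P T (f := f))//.
by congr (_ + _); case: ifP => // _; rewrite EF.
Qed.

(** This is the positivity of mu_{k+1}(P) = mu_k(P) - p mu_k(P \ L(a)), divided by mu_k(P); it is
    what makes the geometric series over the number of blocks converge. *)
Lemma block_weight_lt1 k (P : pred nat) : (k < K)%N -> P k ->
  (0 <= p * mass k P (Rel k) < 1)%R.
Proof.
move=> kK Pk; rewrite mulr_ge0 ?mass_ge0 1?ltnW//=.
have := mu_gt0 P kK; rewrite (muS Pk) subr_gt0.
by rewrite /mass mulrA ltr_pdivrMr ?mul1r ?mu_gt0// ltnW.
Qed.

(** With q the weight of a block and g the accepted mass, the new mass is the old one plus q g / (1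
    - q), and 1 - q = mu_{k+1}(P) / mu_k(P). *)
Lemma E_lam_mass k (P T : pred nat) : (k <= K)%N ->
  E (lam k P T) (fun=> 1) = (mass k P T)%:E.
Proof.
elim: k P T => [|k IH] P T kK; first by rewrite E_lam0// /mass !mu0 divr1.
have kK' := ltnW kK; rewrite E_lamS// IH//.
case: ifP => [Pk|/negbT Pk]; last first.
  by rewrite adde0 /mass !mu_notin//= (negPf Pk).
have Eg := E_lam_accepted P T (f := fun=> 1) (fun=> lee01) (fun P T => IH P T kK').
set g := accepted _ _ _ _ in Eg.
pose q := (p * mass k P (Rel k))%R.
have q01 : (0 <= q < 1)%R by exact: block_weight_lt1.
have qn j : (0 <= q ^+ j)%R by case/andP: q01 => q0 _; rewrite exprn_ge0.
have g0 : (0 <= g)%R by rewrite -lee_fin -Eg; apply: E_ge0 => // v; case: ifP.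
have -> : \esum_(j in [set: nat]) E (lam k P T) (lam_term Rel p k P T (fun=> 1) j) =
    \esum_(j in [set: nat]) (q * g)%:E * (q ^+ j)%:E.
  apply: eq_esum => j _; transitivity (E (lam k P T) (fun v =>
      (q ^+ j.+1)%:E * if accepts Rel k T v then 1 else 0)).
    apply: eq_E => v; rewrite /lam_term; case: ifP => _; last by rewrite mule0.
    by rewrite (E_blocks_mass _ _ _ (IH _ _ kK')) ?mule1// mass_ge0.
  rewrite EZ ?lee_fin//; last by move=> v; case: ifP.
  by rewrite Eg -!EFinM exprS; congr (_%:E); ring.
rewrite ge0_esumZl ?lee_fin//; last by rewrite mulr_ge0// (andP q01).1.
rewrite esum_geometric// -EFinM -EFinD; congr (_%:E).
have : (1 - q != 0)%R by case/andP: q01 => _ q1; rewrite subr_eq0 eq_sym lt_eqF.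
rewrite /g /accepted /q /mass (muS Pk) => q1.
have mun0 : mu k P != 0%R by rewrite gt_eqF ?mu_gt0.
have muq0 : mu k (minus P (Rel k)) != 0%R by rewrite gt_eqF ?mu_gt0.
have mu1n0 : (mu k P - p * mu k (minus P (Rel k)) != 0)%R by rewrite -muS// gt_eqF ?mu_gt0.
(* If [k] is in [T] it is absent from the numerator's alphabet and the numerator does not change;
   otherwise the numerator obeys the same recursion as the denominator. *)
case: (boolP (T k)) => Tk.
  by rewrite mu_notin /= ?Tk ?andbF//; field; rewrite mun0 mu1n0.
rewrite (@muS k (minus P T)) /= ?Pk ?Tk//.
rewrite (@eq_mu k (minus (minus P T) (Rel k)) (minus (minus P (Rel k)) T)); last first.
  by move=> i _ /=; rewrite andbAC.
by field; rewrite mun0 mu1n0 muq0.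
Qed.

Lemma E_lam_size k (P T : pred nat) : (k <= K)%N ->
  E (lam k P T) (fun w => (size w)%:R%:E) = (mean_size k P T)%:E.
Proof.
have sz0 : nn (fun w : seq nat => (size w)%:R%:E : \bar R) by move=> w; rewrite lee_fin.
elim: k P T => [|k IH] P T kK.
  by rewrite E_lam0// /mean_size !mu'0 mul0r mulr0 subrr mulr0 mul0r.
have kK' := ltnW kK; rewrite E_lamS// IH//.
case: ifP => [Pk|/negbT Pk]; last first.
  by rewrite adde0 /mean_size !mu_notin ?mu'_notin//= (negPf Pk).
have Em P' T' := E_lam_mass P' T' kK'.
have Eg := E_lam_accepted P T (f := fun=> 1) (fun=> lee01) Em.
have Eg' := E_lam_accepted P T sz0 (fun P T => IH P T kK').
set g := accepted _ _ _ _ in Eg; set g' := accepted _ _ _ _ in Eg'.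
pose q := (p * mass k P (Rel k))%R.
pose s := (p * (mass k P (Rel k) + mean_size k P (Rel k)))%R.
have q01 : (0 <= q < 1)%R by exact: block_weight_lt1.
have q0 : (0 <= q)%R by case/andP: q01.
have qn j : (0 <= q ^+ j)%R by rewrite exprn_ge0.
have ms0 : (0 <= mean_size k P (Rel k))%R by rewrite -lee_fin -IH//; exact: E_ge0.
have s0 : (0 <= s)%R by rewrite mulr_ge0// addr_ge0// mass_ge0.
have acc0 : nn (fun v => if accepts Rel k T v then 1 else 0 : \bar R) by move=> v; case: ifP.
have acc0' : nn (fun v => if accepts Rel k T v then (size v)%:R%:E else 0 : \bar R).
  by move=> v; case: ifP.
have g0 : (0 <= g)%R by rewrite -lee_fin -Eg; exact: E_ge0.
have g'0 : (0 <= g')%R by rewrite -lee_fin -Eg'; exact: E_ge0.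
have js j : (0 <= j.+1%:R * q ^+ j)%R by rewrite mulr_ge0.
(* The length is that of the j + 1 blocks, which leads to the differentiated series, plus that of
   [v], which leads to the plain geometric one. *)
have -> : \esum_(j in [set: nat])
      E (lam k P T) (lam_term Rel p k P T (fun w => (size w)%:R%:E) j) =
    \esum_(j in [set: nat])
      ((s * g)%:E * (j.+1%:R * q ^+ j)%:E + (q * g')%:E * (q ^+ j)%:E).
  apply: eq_esum => j _; transitivity (E (lam k P T) (fun v =>
      (j.+1%:R * q ^+ j * s)%:E * (if accepts Rel k T v then 1 else 0) +
      (q ^+ j.+1)%:E * (if accepts Rel k T v then (size v)%:R%:E else 0))).
    apply: eq_E => v; rewrite /lam_term; case: ifP => _; last by rewrite !mule0 adde0.
    rewrite (eq_E _ (g := fun xs => (size v)%:R%:E * 1 + (size xs)%:R%:E)); last first.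
      by move=> xs; rewrite mule1 -EFinD size_cat natrD addrC.
    rewrite ED// EZ// (E_blocks_mass _ _ _ (Em _ _)) ?mass_ge0//.
    rewrite (E_blocks_size _ _ _ _ (Em _ _) (IH _ _ kK')) ?mass_ge0//.
    by rewrite mule1 addeC [X in _ + X]muleC.
  have jss : (0 <= j.+1%:R * q ^+ j * s)%R by rewrite mulr_ge0.
  rewrite ED//; [|by move=> v; rewrite mule_ge0 ?lee_fin ?acc0 ?acc0'..].
  rewrite !EZ ?lee_fin// Eg Eg' -!EFinM exprS.
  by congr (_%:E + _%:E); ring.
have sg0 : (0 <= s * g)%R by rewrite mulr_ge0.
have qg0 : (0 <= q * g')%R by rewrite mulr_ge0.
rewrite esumD; [|by move=> j _; rewrite -EFinM lee_fin mulr_ge0..].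
rewrite !ge0_esumZl ?lee_fin//.
rewrite esum_geometric// esum_geometric_deriv// -!EFinM -!EFinD; congr (_%:E).
have : (1 - q != 0)%R by case/andP: q01 => _ q1; rewrite subr_eq0 eq_sym lt_eqF.
rewrite /g /g' /accepted /s /q /mean_size /mass (muS Pk) (mu'S Pk) => q1.
have mun0 : mu k P != 0%R by rewrite gt_eqF ?mu_gt0.
have muq0 : mu k (minus P (Rel k)) != 0%R by rewrite gt_eqF ?mu_gt0.
have mu1n0 : (mu k P - p * mu k (minus P (Rel k)) != 0)%R by rewrite -muS// gt_eqF ?mu_gt0.
case: (boolP (T k)) => Tk.
  by rewrite mu_notin ?mu'_notin /= ?Tk ?andbF//; field; rewrite mun0 mu1n0.
rewrite (@muS k (minus P T)) ?(@mu'S k (minus P T)) /= ?Pk ?Tk//.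
have PTR i : (i < k)%N -> minus (minus P T) (Rel k) i = minus (minus P (Rel k)) T i.
  by move=> _ /=; rewrite andbAC.
rewrite (eq_mu PTR) (eq_mu' PTR).
by field; rewrite mun0 mu1n0 muq0.
Qed.

End GeneratingFunctions.

(** * Each admissible trace has weight p^length *)

Section TraceWeights.
Variables (R : realType) (Rel : rel nat) (p : R).
Hypotheses (Rel_refl : reflexive Rel) (Rel_sym : symmetric Rel) (p_gt0 : 0 < p).
Local Open Scope ereal_scope.
Local Notation lam := (lam Rel p).
Let p_ge0 := ltW p_gt0.
Let nnl k P T := @nn_lam R Rel p p_ge0 k P T.
Let nnb k P T a m := nn_blocks p_ge0 a m (nnl k P T).
Hint Resolve nnl nnb : core.

Definition maxin (T : pred nat) (x : seq nat) : bool :=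
  all (fun b => is_max Rel x b ==> T b) x.

Lemma maxinP (T : pred nat) x : reflect (forall b, is_max Rel x b -> T b) (maxin T x).
Proof.
apply: (iffP allP) => [h b xb|h b _]; last exact/implyP/h.
by have /implyP := h b (is_max_mem xb); apply.
Qed.

Definition ind (x w : seq nat) : \bar R := if `[< tr_eq Rel w x >] then 1 else 0.

Lemma ind_ge0 x : nn (ind x).
Proof. by move=> w; rewrite /ind; case: ifP. Qed.
Hint Resolve ind_ge0 : core.

Let ind_cat_ge0 y v : nn (fun xs => ind y (xs ++ v)).
Proof. by move=> xs; exact: ind_ge0. Qed.
Hint Resolve ind_cat_ge0 : core.

Lemma ind0 x w : ~ tr_eq Rel w x -> ind x w = 0.
Proof. by move=> nwx; rewrite /ind asboolF. Qed.

Lemma ind_all0 (P : pred nat) x w : all P w != all P x -> ind x w = 0.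
Proof.
by move=> wx; apply: ind0 => /(tr_all P) wxE; rewrite wxE eqxx in wx.
Qed.

(** Uniqueness of the factorization splits one condition on the product into independent conditions
    on its two factors. *)
Lemma below_ind k x v w : k \in x -> all (fun i => (i < k)%N) v ->
  (forall b, is_max Rel v b -> Rel k b) ->
  ind x (v ++ k :: w) = ind (below Rel k x).1 v * ind (below Rel k x).2 w.
Proof.
move=> kx vk vmax; have kv : k \notin v.
  by apply/negP => /(allP vk); rewrite ltnn.
have bE := below_cat w kv (fun b _ => vmax b).
rewrite /ind; case: asboolP => [/(below_tr Rel_refl Rel_sym k)|vwx].
  by rewrite bE => -[/= h1 h2]; rewrite !asboolT ?mule1.
case: asboolP => [vD|_]; last by rewrite mul0e.
case: asboolP => [wR|_]; last by rewrite mule0.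
case: vwx; apply: tr_trans (tr_sym Rel_sym (below_eq Rel_sym kx)).
by apply: tr_cat => //; exact: tr_cons.
Qed.

(** Letters to the left of the first [k] are hidden by it, and this [k] is maximal unless something
    after it depends on [k]. The remainder may contain [k] again, in which case reflexivity makes
    [has (Rel k)] true. *)
Lemma maxin_below (k : nat) (T : pred nat) x : k \in x ->
  maxin T x = (T k || has (Rel k) (below Rel k x).2) && maxin T (below Rel k x).2.
Proof.
move=> kx; set D := (below Rel k x).1; set Q := (below Rel k x).2.
have xE b : is_max Rel x b = is_max Rel Q b || ((b == k) && ~~ has (Rel k) Q).
  rewrite (is_max_tr Rel_sym b (below_eq Rel_sym kx)) is_max_cat /= -/D -/Q.
  rewrite -all_predC; have [->|bk] := eqVneq b k.
    by rewrite Rel_refl /= andbF orbF.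
  rewrite /= !orbF; case bD : (is_max Rel D b); rewrite ?orbF//=.
  by rewrite Rel_sym (is_max_below1 bD) orbF.
apply/maxinP/andP => [xT|[Tk /maxinP QT] b].
  split; last by apply/maxinP => b Qb; apply: xT; rewrite xE Qb.
  by rewrite orbC; apply/orP; case: (boolP (has _ _)) => hk;
    [left|right; apply: xT; rewrite xE eqxx hk orbT].
rewrite xE => /orP[/QT//|/andP[/eqP -> /negPf hk]].
by rewrite hk orbF in Tk.
Qed.

Section Step.
Variables (k : nat) (T : pred nat).
Hypothesis IH : forall T x, E (lam k predT T) (ind x) =
  if all (fun i => (i < k)%N) x && maxin T x then (p ^+ size x)%:E else 0.

(** Weight of the class of [y] due to words with exactly [j] blocks. The test [accepts] is kept even
    for [j = 0], so that peeling off blocks always leads to a value of the same function. *)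
Let t j y := E (lam k predT T) (fun v => if accepts Rel k T v then
  E (blocks p (lam k predT (Rel k)) k j) (fun xs => ind y (xs ++ v)) else 0).

Let t_in_ge0 j y : nn (fun v => if accepts Rel k T v then
  E (blocks p (lam k predT (Rel k)) k j) (fun xs => ind y (xs ++ v)) else 0).
Proof. by move=> v; case: ifP => // _; exact: E_ge0. Qed.

Let t_ge0 j y : 0 <= t j y.
Proof. exact: E_ge0. Qed.

Let t0E y : t 0 y = if accepts Rel k T y && all (fun i => (i < k)%N) y && maxin T y
  then (p ^+ size y)%:E else 0.
Proof.
have -> : t 0 y = E (lam k predT T) (fun v => (if accepts Rel k T y then 1 else 0) * ind y v).
  apply: eq_E => v; rewrite E_blocks0// /=.
  rewrite /ind; case: asboolP => [vy|_]; last by case: ifP => _; rewrite mule0.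
  by rewrite /accepts (tr_all _ vy) mule1.
by rewrite EZ// ?IH; case: ifP => //= _; rewrite ?mul1e ?mul0e.
Qed.

Let tS_notin j y : k \notin y -> t j.+1 y = 0.
Proof.
move=> ky; rewrite -(E0 (lam k predT T)); apply: eq_E => v; case: ifP => // _.
rewrite E_blocksS//; rewrite (eq_E _ (g := fun=> 0)) ?E0 ?mule0// => v1.
rewrite (eq_E _ (g := fun=> 0)) ?E0// => xs.
apply: (@ind_all0 (predC1 k)); rewrite !all_cat /= eqxx /= andbF /= eq_sym.
have -> : all (predC1 k) y; last by [].
by apply/allP => i iy /=; apply: contraNneq ky => <-.
Qed.

Let tS_in j y : k \in y -> all (fun i => (i < k.+1)%N) y ->
  t j.+1 y = (p ^+ (size (below Rel k y).1).+1)%:E * t j (below Rel k y).2.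
Proof.
move=> ky yk; rewrite /t -EZ ?lee_fin ?exprn_ge0//; apply: eq_E => v.
case: ifP => // _; last by rewrite mule0.
set D := (below Rel k y).1; set Q := (below Rel k y).2.
rewrite E_blocksS//.
have -> : E (lam k predT (Rel k)) (fun v1 => E (blocks p (lam k predT (Rel k)) k j)
      (fun xs => ind y ((v1 ++ k :: xs) ++ v))) =
    E (lam k predT (Rel k)) (fun v1 => ind D v1 *
      E (blocks p (lam k predT (Rel k)) k j) (fun xs => ind Q (xs ++ v))).
  apply: carried_lam => // [v1|v1|v1 [v1k _ v1max]].
  - by apply: E_ge0 => // xs; exact: ind_ge0.
  - exact: mule_ge0 (ind_ge0 _ _) (E_ge0 (nnb _ _ _ _ _) (ind_cat_ge0 _ _)).
  rewrite -EZ//; last exact: ind_ge0.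
  apply: eq_E => xs.
  by rewrite -catA /= (below_ind _ ky).
rewrite EZr//; last exact: E_ge0.
rewrite IH ifT; last first.
  have /andP[Dk _] := below_all Rel k yk; apply/andP; split.
    apply/allP => i iD; rewrite ltn_neqAle -ltnS (allP Dk)// andbT.
    by apply: contraNneq (notin_below1 Rel k y) => ik; move: iD; rewrite ik.
  by apply/maxinP => b; exact: is_max_below1.
by rewrite muleA -EFinM -exprS.
Qed.

(** Only one [j] can contribute, since the number of blocks is the number of letters [k] in [y].
    Induction on the size of [y] peels off the first block with weight p^(|D| + 1) and stops when
    the remainder no longer contains [k]. *)
Let sum_t y : k \in y -> all (fun i => (i < k.+1)%N) y ->
  \esum_(j in [set: nat]) t j.+1 y = if maxin T y then (p ^+ size y)%:E else 0.
Proof.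
have [n] := ubnP (size y); elim: n y => // n IHn y yn ky yk.
set D := (below Rel k y).1; set Q := (below Rel k y).2.
have sy : size y = (size D + (size Q).+1)%N by exact: size_below.
have pD0 : (0 <= p ^+ (size D).+1)%R by rewrite exprn_ge0.
under eq_esum do rewrite tS_in//.
rewrite ge0_esumZl ?lee_fin// esum_nat_recl// t0E (maxin_below T ky) -/D -/Q.
have /andP[_ Qk] := below_all Rel k yk.
case: (boolP (k \in Q)) => kQ.
  rewrite [X in accepts _ _ _ _ && X](_ : _ = false); last first.
    by apply/negP => /allP/(_ k kQ); rewrite ltnn.
  rewrite andbF /= add0e IHn//; last by move: yn; rewrite sy ltnS => /(leq_trans (leq_addl _ _)).
  have -> : has (Rel k) Q by apply/hasP; exists k.
  rewrite orbT /=; case: ifP => _; rewrite ?mule0// -EFinM -exprD sy.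
  by congr (_ ^+ _)%:E; lia.
have Qk' : all (fun i => (i < k)%N) Q.
  apply/allP => i iQ; rewrite ltn_neqAle -ltnS (allP Qk)// andbT.
  by apply: contraNneq kQ => ik; move: iQ; rewrite ik.
rewrite esum1 ?adde0; last by move=> j _; exact: tS_notin.
rewrite Qk' andbT (_ : accepts Rel k T Q = T k || has (Rel k) Q); last first.
  rewrite /accepts; congr (_ || _); rewrite -[has _ _]negbK -all_predC; congr (~~ _).
  by apply: eq_in_all => i iQ; rewrite (allP Qk').
case: ifP => _; rewrite ?mule0// -EFinM -exprD sy.
by congr (_ ^+ _)%:E; lia.
Qed.

Lemma E_lam_ind_step x : E (lam k.+1 predT T) (ind x) =
  if all (fun i => (i < k.+1)%N) x && maxin T x then (p ^+ size x)%:E else 0.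
Proof.
have [xk|xk] := boolP (all (fun i => (i < k.+1)%N) x); last first.
  transitivity (E (lam k.+1 predT T) (fun=> 0)); last by rewrite E0.
  apply: (carried_lam Rel_sym p_ge0) => // w [wk _ _].
  by apply: (@ind_all0 (fun i => (i < k.+1)%N)); rewrite wk eq_sym; case: all xk.
rewrite E_lamS// IH /=; have [kx|kx] := boolP (k \in x).
  rewrite [X in if X && _ then _ else _](_ : _ = false); last first.
    by apply/negP => /allP/(_ k kx); rewrite ltnn.
  by rewrite add0e -sum_t//; apply: eq_esum => j _; exact: eq_E.
rewrite esum1 => [|j _]; last by rewrite -[RHS](tS_notin j kx); exact: eq_E.
rewrite adde0 (_ : all (fun i => (i < k)%N) x = true)//; apply/allP => i ix.
rewrite ltn_neqAle -ltnS (allP xk)// andbT.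
by apply: contraNneq kx => <-.
Qed.

End Step.

Lemma E_lam_ind k T x : E (lam k predT T) (ind x) =
  if all (fun i => (i < k)%N) x && maxin T x then (p ^+ size x)%:E else 0.
Proof.
elim: k T x => [|k IH] T x; last exact: E_lam_ind_step.
rewrite E_lam0//; case: x => [|a x] /=; last by rewrite (@ind_all0 pred0).
by rewrite /ind asboolT//; exact: tr_refl.
Qed.

(** Every word is equivalent to exactly one normal form, so the indicators of the classes of normal
    forms add up to 1. *)
Lemma esum_lam_nf k T :
  \esum_(y in [set: seq nat]) (if `[< tr_nf Rel y >] then E (lam k predT T) (ind y) else 0) =
  E (lam k predT T) (fun=> 1).
Proof.
transitivity (E (lam k predT T) (fun w =>
    \esum_(y in [set: seq nat]) (if `[< tr_nf Rel y >] then ind y w else 0))).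
  rewrite E_esum//; last by move=> w y; case: ifP => // _; exact: ind_ge0.
  by apply: eq_esum => y _; case: ifP => // _; rewrite E0.
apply: eq_E => w; have [y nfy wy] := tr_nf_exists Rel w.
rewrite (esum_single (t := y)); last 2 first.
- by case: ifP => // _; exact: ind_ge0.
- move=> z zy; case: asboolP => // nfz; apply: ind0 => wz; move/eqP: zy; apply.
  exact: tr_nf_unique nfz nfy wz wy.
by rewrite asboolT// /ind asboolT.
Qed.

Lemma BmaxE (k : nat) (T : pred nat) : (0 <= mu Rel p k predT)%R ->
  Bmax Rel p k T = (mu Rel p k predT)%:E * E (lam k predT T) (fun=> 1).
Proof.
move=> mu0; rewrite -esum_lam_nf -ge0_esumZl ?lee_fin//; last first.
  by move=> y; case: ifP => // _; exact: E_ge0.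
rewrite /Bmax esum_mkcond; apply: eq_esum => y _; rewrite E_lam_ind.
case: asboolP => nfy; last first.
  by rewrite mule0 memNset// => -[].
have -> : (y \in [set y | tr_nf Rel y /\ all (fun a => (a < k)%N) y /\ maxl Rel y `<=` T]) =
    all (fun i => (i < k)%N) y && maxin T y.
  apply/idP/andP; rewrite inE /=.
    move=> [_ [yk yT]]; split=> //; apply/maxinP => b yb.
    by apply: yT; apply/maxlP.
  move=> [yk /maxinP yT]; split=> //; split=> // b /(maxlP Rel_sym); exact: yT.
by case: ifP => _; rewrite ?mule0// EFinM.
Qed.

End TraceWeights.

(** * The repeat loop, the for loop and the geometric draw *)

Section Loops.
Variable R : realType.
Local Open Scope ereal_scope.

Section Repeat.
Variables (body : dist R ((bool * seq nat) * nat)%type) (stop : bool -> seq nat -> bool).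
Hypothesis body_ge0 : nn body.
Local Notation halts o := (stop o.1.1 o.1.2).

Lemma nn_loopn j : nn (loopn body stop j).
Proof.
elim: j => [|j IH] /=; apply: nn_dbind => // o; case: ifP => _; do ?exact: nn_dret.
  exact: nn_dzero.
- exact: nn_dzero.
by apply: nn_dbind => // o'; exact: nn_dret.
Qed.

Lemma nn_loop : nn (loop body stop).
Proof. by move=> o; apply: esum_ge0 => j _; exact: nn_loopn. Qed.

Lemma E_loopn0 f : nn f ->
  E (loopn body stop 0) f = E body (fun o => if halts o then f o else 0).
Proof.
move=> f0; rewrite /= E_dbind//; last first.
  by move=> o; case: ifP => _; [exact: nn_dret|exact: nn_dzero].
by apply: eq_E => o; case: ifP => _; rewrite ?E_dret ?E_dzero.
Qed.

Lemma E_loopnS j f : nn f -> E (loopn body stop j.+1) f = E body (fun o =>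
  if halts o then 0 else E (loopn body stop j) (fun o' => f (o'.1, (o.2 + o'.2)%N))).
Proof.
move=> f0; have nnb o : nn (dbind (loopn body stop j)
    (fun o' => dret (o'.1, (o.2 + o'.2)%N)) : dist R ((bool * seq nat) * nat)%type).
  by apply: nn_dbind => [|o']; [exact: nn_loopn|exact: nn_dret].
rewrite [loopn _ _ _.+1]/= E_dbind//; last first.
  by move=> o; case: ifP => _; [exact: nn_dzero|exact: nnb].
apply: eq_E => o; case: ifP => _; first exact: E_dzero.
rewrite E_dbind//; [|exact: nn_loopn|by move=> o'; exact: nn_dret].
by apply: eq_E => o'; rewrite E_dret.
Qed.

Lemma E_loop f : nn f ->
  E (loop body stop) f = \esum_(j in [set: nat]) E (loopn body stop j) f.
Proof. exact: E_dsum nn_loopn. Qed.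

(** Covers two uses: [h] constant 1, for the law of the outcome, and [h] the exponential of the cost
    of a round, for exponential moments. [rho] is the rejection probability weighted by [h]. *)
Lemma E_loopn_mult (f : (bool * seq nat) * nat -> \bar R) (h : nat -> \bar R) (rho : R) j :
  nn f -> nn h -> (0 <= rho)%R ->
  (forall o c c', f (o, (c + c')%N) = h c * f (o, c')) ->
  E body (fun o => if halts o then 0 else h o.2) = rho%:E ->
  E (loopn body stop j) f =
    (rho ^+ j)%:E * E body (fun o => if halts o then f o else 0).
Proof.
move=> f0 h0 rho0 fh Eh; elim: j => [|j IH]; first by rewrite E_loopn0// expr0 mul1e.
have pj : (0 <= rho ^+ j)%R by rewrite exprn_ge0.
have s0 : nn (fun o => if halts o then f o else 0) by move=> o; case: ifP.
rewrite E_loopnS//.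
rewrite (eq_E _ (g := fun o => (if halts o then 0 else h o.2) * E (loopn body stop j) f)); last first.
  move=> o; case: ifP => _; first by rewrite mul0e.
  rewrite (eq_E _ (g := fun o' => h o.2 * f o')); last by case=> b c'; exact: fh.
  by rewrite EZ//; exact: nn_loopn.
rewrite EZr//; last 2 first.
- by move=> o; case: ifP.
- by apply: E_ge0 => //; exact: nn_loopn.
by rewrite Eh IH muleA -EFinM exprS.
Qed.

Lemma E_loop_mult (f : (bool * seq nat) * nat -> \bar R) (h : nat -> \bar R) (rho : R) :
  nn f -> nn h -> (0 <= rho < 1)%R ->
  (forall o c c', f (o, (c + c')%N) = h c * f (o, c')) ->
  E body (fun o => if halts o then 0 else h o.2) = rho%:E ->
  E (loop body stop) f = ((1 - rho)^-1)%:E * E body (fun o => if halts o then f o else 0).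
Proof.
move=> f0 h0 rho01 fh Eh; have /andP[rho0 _] := rho01.
rewrite E_loop// -esum_geometric// -ge0_esumZr; last 2 first.
- by apply: E_ge0 => // o; case: ifP.
- by move=> j; rewrite lee_fin exprn_ge0.
by apply: eq_esum => j _; exact: E_loopn_mult fh Eh.
Qed.

(** Wald's identity: the mean number of rounds, 1 / (1 - rho), times the mean cost of a round. The
    cost of a round may be correlated with its rejection. *)
Lemma E_loop_cost (rho B : R) : (0 <= rho < 1)%R ->
  E body (fun=> 1) = 1 ->
  E body (fun o => if halts o then 0 else 1) = rho%:E ->
  E body (fun o => o.2%:R%:E) = B%:E ->
  E (loop body stop) (fun o => o.2%:R%:E) = ((1 - rho)^-1 * B)%:E.
Proof.
move=> rho01 E1 Erho EB; have /andP[rho0 rho1] := rho01.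
have nat0 : nn (fun o : (bool * seq nat) * nat => o.2%:R%:E : \bar R).
  by move=> o; rewrite lee_fin.
have acc0 (g : (bool * seq nat) * nat -> \bar R) : nn g ->
    nn (fun o => if halts o then g o else 0) by move=> g0 o; case: ifP.
have rej0 (g : (bool * seq nat) * nat -> \bar R) : nn g ->
    nn (fun o => if halts o then 0 else g o) by move=> g0 o; case: ifP.
have split (g : (bool * seq nat) * nat -> \bar R) : nn g -> E body g =
    E body (fun o => if halts o then g o else 0) +
    E body (fun o => if halts o then 0 else g o).
  move=> g0; rewrite -ED//; [|exact: acc0|exact: rej0].
  by apply: eq_E => o; case: ifP => _; rewrite ?adde0 ?add0e.
have one0 : nn (fun o : (bool * seq nat) * nat => 1 : \bar R) by [].
have Eacc : E body (fun o => if halts o then 1 else 0) = (1 - rho)%:E.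
  have := split _ one0; rewrite E1 Erho; case: (E body _) => //= a [->].
  by rewrite addrK.
have [a [u [a0 u0 Ea Eu aB]]] : exists a u, [/\ (0 <= a)%R, (0 <= u)%R,
    E body (fun o => if halts o then o.2%:R%:E else 0) = a%:E,
    E body (fun o => if halts o then 0 else o.2%:R%:E) = u%:E & (a + u = B)%R].
  have := split _ nat0; rewrite EB.
  have := E_ge0 body_ge0 (acc0 _ nat0); have := E_ge0 body_ge0 (rej0 _ nat0).
  case: (E body _) => [u| |] //; case: (E body _) => [a| |] //.
  by rewrite !lee_fin => u0 a0 [->]; exists a, u.
(* Either the accepted last round is charged, after j rejections of weight rho, or one of the j
   rejected rounds is, which replaces its weight rho by [u] and leaves acceptance its weight 1 -
   rho. *)
have En j : E (loopn body stop j) (fun o => o.2%:R%:E) =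
    (rho ^+ j * a + j%:R * rho ^+ j.-1 * (u * (1 - rho)))%:E.
  elim: j => [|j IH]; first by rewrite E_loopn0// Ea; congr _%:E; rewrite expr0; ring.
  rewrite E_loopnS//; set X := E _ _ in IH.
  have X0 : 0 <= X by apply: E_ge0 => //; exact: nn_loopn.
  have Em : E (loopn body stop j) (fun=> 1) = (rho ^+ j * (1 - rho))%:E.
    by rewrite (E_loopn_mult (h := fun=> 1) (rho := rho))// ?Eacc// => *; rewrite mule1.
  rewrite (eq_E _ (g := fun o => (if halts o then 0 else o.2%:R%:E) * (rho ^+ j * (1 - rho))%:E +
       (if halts o then 0 else 1) * X)); last first.
    move=> o; case: ifP => _; first by rewrite !mul0e adde0.
    rewrite (eq_E _ (g := fun o' => o.2%:R%:E * 1 + o'.2%:R%:E)).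
      rewrite ED ?EZ//; [|exact: nn_loopn..].
      by rewrite Em mul1e.
    by move=> o'; rewrite mule1 -EFinD natrD.
  have c0 : (0 <= rho ^+ j * (1 - rho))%R by rewrite mulr_ge0 ?exprn_ge0// subr_ge0 ltW.
  rewrite ED//; last 2 first.
  - by move=> o; rewrite mule_ge0 ?lee_fin//; exact: rej0 nat0 o.
  - by move=> o; rewrite mule_ge0//; exact: rej0 one0 o.
  rewrite !EZr//; [|exact: rej0..].
  rewrite Eu Erho IH -!EFinM -EFinD; congr _%:E.
  case: j {IH X0 X Em c0} => [|j] /=; first by rewrite !expr0 expr1; ring.
  by rewrite !exprS -(natr1 j.+1); ring.
rewrite E_loop// (eq_esum (fun j _ => En j)).
have pj j : (0 <= rho ^+ j)%R by rewrite exprn_ge0.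
have r1 : (0 <= 1 - rho)%R by rewrite subr_ge0 ltW.
transitivity (\esum_(j in [set: nat]) (a%:E * (rho ^+ j)%:E) +
    \esum_(j in [set: nat]) ((u * (1 - rho))%:E * (j%:R * rho ^+ j.-1)%:E)).
  rewrite -esumD; last 2 first.
  - by move=> j _; rewrite -EFinM lee_fin mulr_ge0.
  - by move=> j _; rewrite -EFinM lee_fin !mulr_ge0.
  by apply: eq_esum => j _; rewrite -!EFinM -EFinD; congr _%:E; ring.
have pj' j : (0 <= j%:R * rho ^+ j.-1)%R by rewrite mulr_ge0.
rewrite !ge0_esumZl ?lee_fin ?mulr_ge0//.
rewrite esum_geometric// [X in _ + _ * X]esum_nat_recl// mul0r add0e.
rewrite esum_geometric_deriv// -!EFinM -EFinD -aB; congr _%:E.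
by field; rewrite subr_eq0 eq_sym lt_eqF.
Qed.

End Repeat.

Section Calls.
Variables (cm : cost_model) (d : dist R (seq nat * nat)%type) (a : nat).
Hypothesis d_ge0 : nn d.

Lemma nn_callsn m : nn (callsn cm d a m).
Proof.
elim: m => [|m IH] /=; first exact: nn_dret.
by apply: nn_dbind => // xs; apply: nn_dbind => // vs; exact: nn_dret.
Qed.

Lemma E_callsn0 f : nn f -> E (callsn cm d a 0) f = f ([::], 0%N).
Proof. exact: E_dret. Qed.

Lemma E_callsnS m f : nn f -> E (callsn cm d a m.+1) f =
  E (callsn cm d a m) (fun xs => E d (fun vs =>
    f (xs.1 ++ vs.1 ++ [:: a], (xs.2 + vs.2 + c_for cm)%N))).
Proof.
move=> f0; rewrite [callsn _ _ _ _.+1]/= E_dbind//; last 2 first.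
- exact: nn_callsn.
- by move=> xs; apply: nn_dbind => // vs; exact: nn_dret.
apply: eq_E => xs; rewrite E_dbind// => [|vs]; last exact: nn_dret.
by apply: eq_E => vs; rewrite E_dret.
Qed.

Lemma E_callsn_mass m : E d (fun=> 1) = 1 -> E (callsn cm d a m) (fun=> 1) = 1.
Proof.
move=> d1; elim: m => [|m IH]; first by rewrite E_callsn0.
by rewrite E_callsnS//; under eq_E do rewrite d1.
Qed.

Lemma E_callsn_cost m (B : R) : E d (fun=> 1) = 1 -> (0 <= B)%R ->
  E d (fun vs => vs.2%:R%:E) = B%:E ->
  E (callsn cm d a m) (fun xs => xs.2%:R%:E) = (m%:R * (B + (c_for cm)%:R))%:E.
Proof.
move=> d1 B0 dB; elim: m => [|m IH]; first by rewrite E_callsn0 ?mul0r// => x; rewrite lee_fin.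
have nat0 : nn (fun o : seq nat * nat => o.2%:R%:E : \bar R) by move=> o; rewrite lee_fin.
rewrite E_callsnS; last by move=> x; rewrite lee_fin.
rewrite (eq_E _ (g := fun xs => xs.2%:R%:E + (B + (c_for cm)%:R)%:E * 1)); last first.
  move=> xs; rewrite (eq_E _ (g := fun vs => (xs.2%:R + (c_for cm)%:R)%:E * 1 + vs.2%:R%:E)).
    rewrite ED ?EZ ?lee_fin ?addr_ge0//.
    by rewrite d1 dB -!EFinM -!EFinD; congr _%:E; ring.
  by move=> vs /=; rewrite mule1 -EFinD !natrD; congr _%:E; ring.
have nnc := nn_callsn m.
rewrite ED ?EZ ?lee_fin ?addr_ge0//; last by move=> x; rewrite mule_ge0 ?lee_fin ?addr_ge0.
rewrite (E_callsn_mass _ d1) IH -!EFinM -!EFinD -natr1; congr _%:E; ring.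
Qed.

Lemma E_callsn_mult m (f : seq nat * nat -> \bar R) (b : R) : nn f -> (0 <= b)%R ->
  f ([::], 0%N) = 1 ->
  (forall xs vs, f (xs.1 ++ vs.1 ++ [:: a], (xs.2 + vs.2 + c_for cm)%N) =
    f xs * f (vs.1 ++ [:: a], (vs.2 + c_for cm)%N)) ->
  E d (fun vs => f (vs.1 ++ [:: a], (vs.2 + c_for cm)%N)) = b%:E ->
  E (callsn cm d a m) f = (b ^+ m)%:E.
Proof.
move=> f0 b0 f1 fM Eb; elim: m => [|m IH]; first by rewrite E_callsn0// f1.
rewrite E_callsnS//; under eq_E do under eq_E do rewrite fM.
under eq_E do rewrite EZ ?Eb//.
have nnc := nn_callsn m.
by rewrite EZr ?lee_fin// IH -EFinM exprSr.
Qed.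

Section Law.
Variables (p w : R) (D : dist R (seq nat)).
Hypotheses (p0 : (0 <= p)%R) (w0 : (0 <= w)%R) (D0 : nn D).
Hypothesis d_law : forall f, nn f -> E d (fun vs => f vs.1) = w%:E * E D f.
Let nnb m := nn_blocks p0 a m D0.
Hint Resolve nnb : core.

(** [blocks] adds its factors in front whereas [callsn] appends them; this recursion at the other
    end reconciles the two. *)
Lemma E_blocks_rcons m f : nn f -> E (blocks p D a m.+1) f =
  p%:E * E (blocks p D a m) (fun xs => E D (fun v => f (xs ++ v ++ [:: a]))).
Proof.
elim: m f => [|m IH] f f0.
  rewrite E_blocksS// E_blocks0; last by move=> x; exact: E_ge0.
  by congr (_ * _); apply: eq_E => v; rewrite E_blocks0// => x; exact: f0.
rewrite E_blocksS// [in RHS]E_blocksS//; last by move=> x; exact: E_ge0.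
congr (_ * _); rewrite -EZ ?lee_fin//; last first.
  by move=> v; apply: E_ge0 => // xs; exact: E_ge0.
apply: eq_E => v; rewrite IH; last by move=> x; exact: f0.
by congr (_ * _); apply: eq_E => xs; apply: eq_E => v'; rewrite -catA.
Qed.

(** A call weighs its factor by w [D] where a block weighs it by p [D], hence a ratio w / p for each
    of the m factors. *)
Lemma E_callsn_law m f : nn f -> (0 < p)%R ->
  E (callsn cm d a m) (fun xs => f xs.1) = ((w / p) ^+ m)%:E * E (blocks p D a m) f.
Proof.
move=> + pgt0; elim: m f => [|m IH] f f0.
  by rewrite E_callsn0// E_blocks0// expr0 mul1e.
rewrite E_callsnS// E_blocks_rcons//.
rewrite (eq_E _ (g := fun xs => w%:E * E D (fun v => f (xs.1 ++ v ++ [:: a])))); last first.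
  by move=> xs; rewrite -d_law.
rewrite EZ ?lee_fin//; [|exact: nn_callsn|by move=> xs; exact: E_ge0].
rewrite (IH (fun xs => E D (fun v => f (xs ++ v ++ [:: a])))); last first.
  by move=> xs; exact: E_ge0.
rewrite !muleA -!EFinM; congr (_%:E * _).
by rewrite exprSr; field; rewrite gt_eqF.
Qed.

End Law.
End Calls.

Lemma E_dK (cm : cost_model) (r : R) (b : bool) (F : nat * nat -> \bar R) :
  (0 <= r <= 1)%R -> nn F ->
  E (if b then dbind (dgeom r) (fun G => dret (G.+1, c_draw cm G))
     else dret (0%N, c_K0 cm)) F =
  if b then \esum_(j in [set: nat]) ((1 - r) * r ^+ j)%:E * F (j.+1, c_draw cm j)
  else F (0%N, c_K0 cm).
Proof.
move=> r01 F0; case: b; last exact: E_dret.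
rewrite E_dbind//; [|exact: nn_dgeom|by move=> j; exact: nn_dret].
by rewrite E_dgeom; apply: eq_esum => j _; rewrite E_dret.
Qed.

End Loops.

(** * Law of the output of the procedure *)

Section Algorithm.
Variables (R : realType) (Rel : rel nat) (cm : cost_model) (p : R).
Hypotheses (Rel_refl : reflexive Rel) (Rel_sym : symmetric Rel) (p_gt0 : 0 < p).
Variable K : nat.
Hypothesis mu_gt0 : forall k (P : pred nat), (k <= K)%N -> 0 < mu Rel p k P.
Local Open Scope ereal_scope.
Local Notation mu := (mu Rel p).
Local Notation mu' := (mu' Rel p).
Local Notation lam := (lam Rel p).
Local Notation mass := (mass Rel p).
Local Notation A2 := (A2 Rel cm p).
Local Notation minus P Q := (predI P (predC Q)).
Let p_ge0 := ltW p_gt0.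
Let nnl k P T := @nn_lam R Rel p p_ge0 k P T.
Let nnb k P T a m := nn_blocks p_ge0 a m (nnl k P T).
Hint Resolve nnl nnb : core.

(** This and the following definitions name the local pieces of [A2] verbatim, so that [A2S] holds
    by computation. *)
Definition touches k l := [exists i : 'I_k.+1, Rel l.-1 i].

Definition hit k l := [exists i : 'I_k.+1,
  connect (fun x y : 'I_k.+1 => Rel x y) ord_max i && Rel l.-1 i].

Definition rate k l : R :=
  if hit k l then (1 - mu k.+1 predT / mu k predT)%R else 0%R.

Definition stop k l (b : bool) (v : seq nat) :=
  ~~ b || Rel l.-1 k || ~~ all (fun x => (x < k)%N && ~~ Rel k x) v.

Definition body k l : dist R ((bool * seq nat) * nat)%type :=
  dbind (dflip (rate k l)) (fun b => dbind (A2 k l) (fun vs =>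
    dret ((b, vs.1), (vs.2 + c_iter cm)%N))).

Definition dK k l (b : bool) : dist R (nat * nat)%type :=
  if b then dbind (dgeom (rate k l)) (fun G => dret (G.+1, c_draw cm G))
  else dret (0%N, c_K0 cm).

Lemma A2S k l : A2 k.+1 l =
  if ~~ touches k l then dret ([::], c_triv cm) else
  dbind (loop (body k l) (stop k l)) (fun o =>
  dbind (dK k l o.1.1) (fun Kc =>
  dbind (callsn cm (A2 k k.+1) k Kc.1) (fun xs =>
  dret (xs.1 ++ o.1.2, (c_setup cm + o.2 + Kc.2 + xs.2 + c_end cm)%N)))).
Proof. by []. Qed.

Lemma mu_le k : (k < K)%N -> (mu k.+1 predT <= mu k predT)%R.
Proof.
move=> kK; rewrite (muS p Rel_refl Rel_sym)// gerBl; apply: mulr_ge0 => //.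
exact/ltW/mu_gt0/ltnW.
Qed.

Lemma mu_le1 k : (k <= K)%N -> (mu k predT <= 1)%R.
Proof.
elim: k => [|k IH] kK; first by rewrite mu0.
exact: le_trans (mu_le kK) (IH (ltnW kK)).
Qed.

Lemma rate_mass k l : (k <= K)%N -> hit k l ->
  rate k l = (p * mass k predT (Rel k))%R.
Proof.
move=> kK h; rewrite /rate h (muS p Rel_refl Rel_sym)// /mass.
by field; rewrite gt_eqF ?mu_gt0.
Qed.

Lemma rate_lt1 k l : (k < K)%N -> (0 <= rate k l < 1)%R.
Proof.
move=> kK; rewrite /rate; case: ifP => _; last by rewrite lexx ltr01.
have mk := mu_gt0 predT (ltnW kK); have mk1 := mu_gt0 predT kK.
rewrite subr_ge0 ler_pdivrMr// mul1r mu_le//= ltrBlDr ltrDl.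
by rewrite divr_gt0.
Qed.

Lemma rate_le1 k l : (k < K)%N -> (0 <= rate k l <= 1)%R.
Proof. by move=> kK; have /andP[-> /ltW] := rate_lt1 l kK. Qed.

Lemma nn_dK k l b : (k < K)%N -> nn (dK k l b).
Proof.
move=> kK; case: b => /=; last exact: nn_dret.
by apply: nn_dbind => [|j]; [exact/nn_dgeom/rate_le1|exact: nn_dret].
Qed.

Lemma nn_A2 k l : (k <= K)%N -> nn (A2 k l).
Proof.
elim: k l => [|k IH] l kK; first exact: nn_dret.
rewrite A2S; case: ifP => _; first exact: nn_dret.
apply: nn_dbind => [|o].
  apply: nn_loop; apply: nn_dbind => [|b]; first exact/nn_dflip/rate_le1.
  by apply: nn_dbind => [|vs]; [exact: IH (ltnW kK)|exact: nn_dret].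
apply: nn_dbind => [|Kc]; first exact: nn_dK.
apply: nn_dbind => [|xs]; last exact: nn_dret.
by apply: nn_callsn; exact: IH (ltnW kK).
Qed.

Lemma nn_body k l : (k < K)%N -> nn (body k l).
Proof.
move=> kK; apply: nn_dbind => [|b]; first exact/nn_dflip/rate_le1.
by apply: nn_dbind => [|vs]; [exact: nn_A2 (ltnW kK)|exact: nn_dret].
Qed.

Lemma E_A2S k l F : (k < K)%N -> touches k l -> nn F -> E (A2 k.+1 l) F =
  E (loop (body k l) (stop k l)) (fun o => E (dK k l o.1.1) (fun Kc =>
    E (callsn cm (A2 k k.+1) k Kc.1) (fun xs =>
      F (xs.1 ++ o.1.2, (c_setup cm + o.2 + Kc.2 + xs.2 + c_end cm)%N)))).
Proof.
move=> kK t F0; rewrite A2S t /=; have nnA := nn_A2 _ (ltnW kK).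
have nnc m : nn (callsn cm (A2 k k.+1) k m) by exact: nn_callsn.
rewrite E_dbind//; last 2 first.
- exact/nn_loop/nn_body.
- move=> o; apply: nn_dbind => [|Kc]; first exact: nn_dK.
  by apply: nn_dbind => // xs; exact: nn_dret.
apply: eq_E => o; rewrite E_dbind//; last 2 first.
- exact: nn_dK.
- by move=> Kc; apply: nn_dbind => // xs; exact: nn_dret.
apply: eq_E => Kc; rewrite E_dbind//; last by move=> xs; exact: nn_dret.
by apply: eq_E => xs; rewrite E_dret.
Qed.

Lemma E_body k l F : (k < K)%N -> nn F -> E (body k l) F =
  (rate k l)%:E * E (A2 k l) (fun vs => F ((true, vs.1), (vs.2 + c_iter cm)%N)) +
  (1 - rate k l)%:E * E (A2 k l) (fun vs => F ((false, vs.1), (vs.2 + c_iter cm)%N)).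
Proof.
move=> kK F0; have nnA := nn_A2 l (ltnW kK).
have nnd b : nn (dbind (A2 k l) (fun vs => dret ((b, vs.1), (vs.2 + c_iter cm)%N))
    : dist R ((bool * seq nat) * nat)%type).
  by apply: nn_dbind => // vs; exact: nn_dret.
rewrite E_dbind//; last exact/nn_dflip/rate_le1.
rewrite E_dflip ?rate_le1//; last by move=> b; exact: E_ge0.
by congr (_ * _ + _ * _); rewrite E_dbind//; try (by move=> vs; exact: nn_dret);
  apply: eq_E => vs; rewrite E_dret.
Qed.

Section Step.
Variables (k l : nat).
Hypotheses (kK : (k < K)%N) (d1 : E (A2 k l) (fun=> 1) = 1).
Let r := rate k l.
Let T : pred nat := Rel l.-1.
Local Notation halts o := (stop k l o.1.1 o.1.2).
Let nnA : nn (A2 k l) := nn_A2 l (ltnW kK).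
Let r01 : (0 <= r < 1)%R := rate_lt1 l kK.
Let r0 : (0 <= r)%R. Proof. by case/andP: r01. Qed.
Let r1 : (0 <= 1 - r)%R. Proof. by case/andP: r01 => _ /ltW; rewrite subr_ge0. Qed.

Lemma E_body_halts F : nn F -> E (body k l) (fun o => if halts o then F o else 0) =
  r%:E * E (A2 k l) (fun vs =>
    if accepts Rel k T vs.1 then F ((true, vs.1), (vs.2 + c_iter cm)%N) else 0) +
  (1 - r)%:E * E (A2 k l) (fun vs => F ((false, vs.1), (vs.2 + c_iter cm)%N)).
Proof. by move=> F0; rewrite E_body// => o; case: ifP. Qed.

Lemma E_body_rejects F : nn F -> E (body k l) (fun o => if halts o then 0 else F o) =
  r%:E * E (A2 k l) (fun vs =>
    if accepts Rel k T vs.1 then 0 else F ((true, vs.1), (vs.2 + c_iter cm)%N)).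
Proof.
move=> F0; rewrite E_body//; last by move=> o; case: ifP.
by rewrite [X in _ + _ * X]E0 mule0 adde0.
Qed.

Definition reject_rate := fine (E (body k l) (fun o => if halts o then 0 else 1)).
Let rho := reject_rate.

(** A round can be rejected only when R = 1, hence rho <= r < 1. *)
Let reject_bound : 0 <= E (body k l) (fun o => if halts o then 0 else 1) <= r%:E.
Proof.
apply/andP; split; first by apply: E_ge0 => [|o]; [exact: nn_body|case: ifP].
rewrite E_body_rejects// -[leRHS]mule1 lee_wpmul2l ?lee_fin//.
by rewrite -[X in _ <= X]d1; apply: le_E => // vs; case: ifP.
Qed.

Lemma reject_rateE : E (body k l) (fun o => if halts o then 0 else 1) = rho%:E.
Proof.
rewrite fineK// ge0_fin_numE ?(andP reject_bound).1//.
exact: le_lt_trans (andP reject_bound).2 (ltry _).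
Qed.

Lemma reject_rate_le : (0 <= rho <= r)%R.
Proof. by have := reject_bound; rewrite reject_rateE !lee_fin. Qed.

Let rho01 : (0 <= rho < 1)%R.
Proof.
have /andP[-> /= h] := reject_rate_le; by case/andP: r01 => _; exact: le_lt_trans.
Qed.

Lemma E_body1 : E (body k l) (fun=> 1) = 1.
Proof. by rewrite E_body// d1 !mule1 -EFinD addrC subrK. Qed.

Lemma E_body_accept : E (body k l) (fun o => if halts o then 1 else 0) = (1 - rho)%:E.
Proof.
have : E (body k l) (fun o => if halts o then 1 else 0) + rho%:E = 1.
  rewrite -reject_rateE -ED; last 3 first.
  - exact: nn_body.
  - by move=> o; case: ifP.
  - by move=> o; case: ifP.
  by rewrite -[RHS]E_body1; apply: eq_E => o; case: ifP => _; rewrite ?adde0 ?add0e.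
exact: fin_subtr.
Qed.

Lemma E_loop_out (g : bool * seq nat -> \bar R) : nn g ->
  E (loop (body k l) (stop k l)) (fun o => g o.1) = ((1 - rho)^-1)%:E *
    (r%:E * E (A2 k l) (fun vs => if accepts Rel k T vs.1 then g (true, vs.1) else 0) +
     (1 - r)%:E * E (A2 k l) (fun vs => g (false, vs.1))).
Proof.
move=> g0; have g0' : nn (fun o : (bool * seq nat) * nat => g o.1) by move=> o; exact: g0.
rewrite (E_loop_mult (nn_body l kK) g0' (h := fun=> 1) _ rho01)//.
- by rewrite E_body_halts.
- by move=> *; rewrite mul1e.
- exact: reject_rateE.
Qed.

Lemma E_loop1 : E (loop (body k l) (stop k l)) (fun=> 1) = 1.
Proof.
rewrite (E_loop_mult (nn_body l kK) (h := fun=> 1) _ _ rho01)//.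
- rewrite E_body_accept -EFinM mulVf// subr_eq0 eq_sym.
  by case/andP: rho01 => _ /lt_eqF ->.
- by move=> *; rewrite mul1e.
- exact: reject_rateE.
Qed.

(** Rounds with R = 1 have probability r, of which rho is rejected; conditioning on acceptance
    divides r - rho by 1 - rho. *)
Lemma E_loop_bool : E (loop (body k l) (stop k l)) (fun o => if o.1.1 then 1 else 0) =
  ((r - rho) / (1 - rho))%:E.
Proof.
rewrite (E_loop_out (g := fun o => if o.1 then 1 else 0)); last by move=> o; case: ifP.
rewrite E0 mule0 adde0.
have := E_body_accept; rewrite (E_body_halts (F := fun=> 1))// d1 mule1.
by move/fin_subtr ->; rewrite -EFinM; congr _%:E; rewrite mulrC; congr (_ / _)%R; ring.
Qed.

End Step.

(** This is almost sure termination: [loop] adds up only executions with finitely many rounds, so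
    mass 1 has to be proved. *)
Lemma E_A2_mass k l : (k <= K)%N -> E (A2 k l) (fun=> 1) = 1.
Proof.
elim: k l => [|k IH] l kK; first exact: E_dret.
have kK' := ltnW kK; case: (boolP (touches k l)) => t; last by rewrite A2S t E_dret.
rewrite E_A2S//; rewrite -[RHS](E_loop1 kK (IH l kK')); apply: eq_E => o.
under eq_E do rewrite (E_callsn_mass _ _ (nn_A2 _ kK') _ (IH _ kK')).
rewrite E_dK ?rate_le1//; case: ifP => // _.
have r01 := rate_lt1 l kK; have /andP[r0 r1] := r01.
transitivity (\esum_(j in [set: nat]) (1 - rate k l)%:E * (rate k l ^+ j)%:E).
  by apply: eq_esum => j _; rewrite mule1 -EFinM.
rewrite ge0_esumZl ?lee_fin ?subr_ge0 ?ltW//; last by move=> j; rewrite lee_fin exprn_ge0.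
by rewrite esum_geometric// -EFinM divff// subr_eq0 eq_sym lt_eqF.
Qed.

Lemma mass_gt0 k (T : pred nat) : (k <= K)%N -> (0 < mass k predT T)%R.
Proof. by move=> kK; rewrite divr_gt0 ?mu_gt0. Qed.

(** A nonempty word has a maximal letter, and here no letter of the alphabet is admissible as one;
    only the empty word is left. *)
Lemma lam_untouched k l f : (k < K)%N -> nn f -> ~~ touches k l ->
  E (lam k.+1 predT (Rel l.-1)) f = f [::] * (mass k.+1 predT (Rel l.-1))%:E.
Proof.
move=> kK f0 nt; rewrite -(E_lam_mass Rel_refl Rel_sym p_gt0 mu_gt0)// -EZ//.
apply: carried_lam => // [w|w [wk _ wT]]; rewrite mule1//.
have [->//|wn0] := eqVneq w [::].
have [//||b bmax _] := @closed_is_max Rel predT w.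
  by case: w wn0 {wk wT}.
have bk : (b < k.+1)%N := allP wk _ (is_max_mem bmax).
by case/negP: nt; apply/existsP; exists (Ordinal bk); exact: wT.
Qed.

(** Justifies r = 0. An accepted [v] would contain a letter in the connected component of a_k, or
    a_k itself would be admissible. In the first case [closed_is_max] gives a maximal letter of [v]
    in that component, which would then meet L(a_l). So no admissible trace contains a_k. *)
Lemma lam_not_hit k l f : (k < K)%N -> nn f -> ~~ hit k l ->
  E (lam k.+1 predT (Rel l.-1)) f = E (lam k predT (Rel l.-1)) f.
Proof.
move=> kK f0 nh; rewrite E_lamS//= esum1 ?adde0// => j _.
transitivity (E (lam k predT (Rel l.-1)) (fun=> 0)); last exact: E0.
apply: carried_lam => // [v|v [vk _ vT]]; first exact: lam_term_ge0.
rewrite /lam_term; case: ifP => //; rewrite /accepts => /orP[lk|].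
  by case/existsP: nh; exists ord_max; rewrite connect0.
rewrite -has_predC => /hasP[x xv /=]; rewrite (allP vk _ xv) /= negbK => kx.
pose C := [pred y | [exists i : 'I_k.+1,
  connect (fun x y : 'I_k.+1 => Rel x y) ord_max i && (val i == y)]].
have [||b bmax] := @closed_is_max Rel C v.
- move=> a b bv /existsP[i /andP[ci /eqP <-]] ib; apply/existsP.
  have bk : (b < k.+1)%N by rewrite ltnS ltnW// (allP vk).
  exists (Ordinal bk); rewrite /= eqxx andbT.
  by apply: connect_trans ci _; exact: connect1.
- apply/hasP; exists x => //; apply/existsP.
  have xk : (x < k.+1)%N by rewrite ltnS ltnW// (allP vk).
  by exists (Ordinal xk); rewrite /= eqxx andbT; exact: connect1.
move=> /existsP[i /andP[ci /eqP ib]]; case/existsP: nh; exists i.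
by rewrite ci /= ib vT.
Qed.

Lemma E_A2_law k l f : (k <= K)%N -> nn f ->
  E (A2 k l) (fun ws => f ws.1) =
  ((mass k predT (Rel l.-1))^-1)%:E * E (lam k predT (Rel l.-1)) f.
Proof.
elim: k l f => [|k IH] l f kK f0.
  rewrite E_lam0// [LHS]E_dret//.
  by rewrite /mass !mu0 divr1 invr1 mul1e.
have kK' := ltnW kK; have M0 := mass_gt0 (Rel l.-1) kK.
case: (boolP (touches k l)) => t; last first.
  rewrite lam_untouched// A2S t [LHS]E_dret//.
  by rewrite muleCA -EFinM mulVf ?mule1// gt_eqF.
(* Proportionality is enough: taking [f] constant 1 on both sides identifies the constant. *)
suff [C C0 EC] : exists2 C : R, (0 <= C)%R & forall f, nn f ->
    E (A2 k.+1 l) (fun ws => f ws.1) = C%:E * E (lam k.+1 predT (Rel l.-1)) f.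
  have := EC (fun=> 1) (fun=> lee01).
  rewrite E_A2_mass// (E_lam_mass Rel_refl Rel_sym p_gt0 mu_gt0)// => -[C1].
  rewrite EC//; congr (_%:E * _); rewrite -[RHS]mul1r C1 -mulrA divff ?mulr1//.
  by rewrite gt_eqF.
have d1 := E_A2_mass l kK'; have Wk := mass_gt0 (Rel l.-1) kK'.
have /andP[rho0 rhor] := reject_rate_le kK d1; have r01 := rate_lt1 l kK.
have /andP[r0 r1] := r01.
have rho1 : (0 < 1 - reject_rate k l)%R by rewrite subr_gt0 (le_lt_trans rhor).
(* The factors come from conditioning on acceptance, from the end of the geometric draw (or from R =
   0), and from the normalisation of the law of [v]. *)
exists ((1 - reject_rate k l)^-1 * (1 - rate k l) * (mass k predT (Rel l.-1))^-1)%R.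
  apply: mulr_ge0; first apply: mulr_ge0; rewrite ?invr_ge0 ?ltW//.
  by rewrite subr_gt0.
move=> {}f {}f0; rewrite E_A2S//.
pose Bl j := E (blocks p (lam k predT (Rel k)) k j).
pose q := ((mass k predT (Rel k))^-1 / p)%R.
have Ec m v : E (callsn cm (A2 k k.+1) k m) (fun xs => f (xs.1 ++ v)) =
    (q ^+ m)%:E * Bl m (fun xs => f (xs ++ v)).
  have w0 : (0 <= (mass k predT (Rel k))^-1)%R by rewrite invr_ge0 ltW// mass_gt0.
  have lawk g : nn g -> E (A2 k k.+1) (fun vs => g vs.1) =
      ((mass k predT (Rel k))^-1)%:E * E (lam k predT (Rel k)) g by exact: IH.
  by rewrite (E_callsn_law cm k (nn_A2 k.+1 kK') p_ge0 w0 (nnl _ _ _) lawk m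
    (f := fun xs => f (xs ++ v))) // => xs; exact: f0.
have q0 : (0 <= q)%R by rewrite divr_ge0// invr_ge0 ltW// mass_gt0.
(* Integrates out K and the calls v_i, leaving a function of the outcome (R, v_oo) of the loop. *)
pose g (o : bool * seq nat) := if o.1 then \esum_(j in [set: nat])
  ((1 - rate k l) * rate k l ^+ j)%:E * ((q ^+ j.+1)%:E * Bl j.+1 (fun xs => f (xs ++ o.2)))
  else f o.2.
have gT v : g (true, v) = \esum_(j in [set: nat]) ((1 - rate k l) * rate k l ^+ j)%:E *
    ((q ^+ j.+1)%:E * Bl j.+1 (fun xs => f (xs ++ v))) by [].
have Bl0 j v : 0 <= Bl j (fun xs => f (xs ++ v)).
  by apply: E_ge0 => // xs; exact: f0.
have g0 : nn g.
  move=> o; rewrite /g; case: ifP => // _; apply: esum_ge0 => j _.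
  by rewrite !mule_ge0 ?lee_fin ?exprn_ge0// mulr_ge0 ?exprn_ge0// subr_ge0 ltW.
rewrite (eq_E _ (g := fun o => g o.1)); last first.
  move=> o; rewrite /dK E_dK ?rate_le1//; last first.
    by move=> x; apply: E_ge0 => [|y]; [exact/nn_callsn/nn_A2|exact: f0].
  rewrite /g; case: ifP => _; last by rewrite E_callsn0// => x; exact: f0.
  by apply: eq_esum => j _; rewrite Ec.
rewrite E_loop_out// (IH _ _ kK' f0).
have acc0 : nn (fun v => if accepts Rel k (Rel l.-1) v then g (true, v) else 0).
  by move=> v; case: ifP.
rewrite (IH l _ kK' acc0) [in RHS]muleC.
case: (boolP (hit k l)) => h; last first.
  rewrite /rate (negPf h) mul0e add0e subr0 mul1e mulr1 lam_not_hit//.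
  by rewrite muleA -EFinM muleC.
(* The crux: R = 1 and K = j + 1 contribute r (1 - r) r^j q^(j+1) = (1 - r) (r q)^(j+1), which is 1
   - r for every j, the same constant as for R = 0. *)
have qE : (rate k l * q = 1)%R.
  rewrite rate_mass// /q; field.
  by rewrite !gt_eqF// mass_gt0.
rewrite E_lamS//=.
have -> : (rate k l)%:E * (((mass k predT (Rel l.-1))^-1)%:E *
     E (lam k predT (Rel l.-1)) (fun v => if accepts Rel k (Rel l.-1) v then g (true, v) else 0)) =
   ((mass k predT (Rel l.-1))^-1)%:E * ((1 - rate k l)%:E * \esum_(j in [set: nat])
     E (lam k predT (Rel l.-1)) (lam_term Rel p k predT (Rel l.-1) f j)).
  rewrite muleCA; congr (_ * _); rewrite -E_esum//; last first.
    by move=> v j; exact: lam_term_ge0.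
  rewrite -!EZ ?lee_fin ?subr_ge0 ?(ltW r1)//; last first.
    by move=> v; apply: esum_ge0 => j _; exact: lam_term_ge0.
  apply: eq_E => v; rewrite /lam_term; case: ifP => _; last first.
    by rewrite mule0 esum1 ?mule0.
  rewrite gT -!ge0_esumZl ?lee_fin ?subr_ge0 ?(ltW r1)//.
  - apply: eq_esum => j _; rewrite !muleA -!EFinM; congr (_%:E * _).
    transitivity ((1 - rate k l) * (rate k l * q) ^+ j.+1)%R.
      by rewrite (exprMn _ (rate k l) q) !(exprS (rate k l)); ring.
    by rewrite qE expr1n mulr1.
  - move=> j; apply: mule_ge0; first by rewrite lee_fin mulr_ge0 ?exprn_ge0// subr_ge0 ltW.
    by apply: mule_ge0; [rewrite lee_fin exprn_ge0|exact: Bl0].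
  - by move=> j; exact: Bl0.
have b0 : (0 <= 1 - rate k l)%R by rewrite subr_ge0 ltW.
have S0 : 0 <= \esum_(j in [set: nat])
     E (lam k predT (Rel l.-1)) (lam_term Rel p k predT (Rel l.-1) f j).
  by apply: esum_ge0 => j _; apply: E_ge0 => // v; exact: lam_term_ge0.
have X0 : 0 <= E (lam k predT (Rel l.-1)) f by exact: E_ge0.
rewrite [(1 - rate k l)%:E * (_ * E _ f)]muleCA.
rewrite -ge0_muleDr ?mule_ge0 ?lee_fin// -ge0_muleDr// addeC.
by rewrite [RHS]muleC !muleA -!EFinM mulrAC.
Qed.

(** * Exponential moments and finite variances *)

Definition wt (ws : seq nat * nat) : R := (size ws.1 + ws.2)%:R.

Lemma wt_ge0 ws : (0 <= wt ws)%R. Proof. exact: ler0n. Qed.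

(** Convexity of exp between 0 and y. The tangent inequality at th y is applied at both endpoints
    and the results are averaged with weights 1 - th and th. *)
Lemma expR_scale (th y : R) : (0 <= th <= 1)%R -> (expR (th * y) <= 1 + th * expR y)%R.
Proof.
move=> /andP[th0 th1].
have hA := @expR_ge1Dx R (y - th * y); have hB := @expR_ge1Dx R (- (th * y)).
have e0 := expR_gt0 (th * y).
have eA : (expR y = expR (th * y) * expR (y - th * y))%R by rewrite -expRD addrC subrK.
have eB : (expR (th * y) * expR (- (th * y)) = 1)%R by rewrite -expRD subrr expR0.
rewrite eA; set e := expR (th * y) in e0 eB *.
set A := expR _ in hA *; set B := expR _ in hB eB *.
have h1 : (th * (1 + (y - th * y)) <= th * A)%R by rewrite ler_wpM2l.
have h2 : ((1 - th) * (1 - th * y) <= (1 - th) * B)%R by rewrite ler_wpM2l// subr_ge0.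
have h3 : (1 <= th * A + (1 - th) * B)%R by lra.
have : (e * 1 <= e * (th * A + (1 - th) * B))%R by rewrite ler_wpM2l// ltW.
rewrite mulrDr [(e * ((1 - th) * B))%R]mulrCA eB; lra.
Qed.

Lemma sqr_le_expR (y : R) : (0 <= y)%R -> (y ^+ 2 <= 4 * expR y)%R.
Proof.
move=> y0; have h := @expR_ge1Dx R (y / 2).
have -> : expR y = (expR (y / 2) ^+ 2)%R by rewrite expr2 -expRD -splitr.
have : ((1 + y / 2) ^+ 2 <= expR (y / 2) ^+ 2)%R.
  by rewrite ler_pXn2r// nnegrE ?expR_ge0// addr_ge0// divr_ge0.
nra.
Qed.

(** The bound tends to 1 with [th], even after adding a deterministic cost [e]; this is how a moment
    is brought close to 1. *)
Lemma E_exp_scale (d : dist R (seq nat * nat)%type) (s th M : R) (e : nat) :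
  nn d -> E d (fun=> 1) = 1 -> (0 <= th <= 1)%R ->
  E d (fun ws => (expR (s * wt ws))%:E) <= M%:E ->
  E d (fun ws => (expR (th * s * (wt ws + e%:R)))%:E) <=
    (1 + th * (expR (s * e%:R) * M))%:E.
Proof.
move=> d0 d1 th01 dM; have /andP[th0 _] := th01.
have c0 : (0 <= th * expR (s * e%:R))%R by rewrite mulr_ge0// expR_ge0.
have ex0 : nn (fun ws => (expR (s * wt ws))%:E) by move=> ws; rewrite lee_fin expR_ge0.
apply: (@le_trans _ _ (E d (fun ws => 1 + (th * expR (s * e%:R))%:E * (expR (s * wt ws))%:E))).
  apply: le_E => // ws; rewrite -EFinM -EFinD lee_fin -mulrA.
  apply: le_trans (expR_scale _ th01) _.
  by rewrite lerD2l -mulrA -expRD -mulrDr [(_ + wt ws)%R]addrC lexx.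
rewrite ED//; last by move=> ws; rewrite mule_ge0 ?lee_fin.
rewrite EZ ?lee_fin// d1 EFinD leeD2l// mulrA [in leRHS]EFinM.
by rewrite lee_wpmul2l ?lee_fin.
Qed.

Lemma ge0_le_fin (x : \bar R) (b : R) : 0 <= x -> x <= b%:E ->
  exists2 a : R, (0 <= a <= b)%R & x = a%:E.
Proof. by case: x => [a| |] //; rewrite !lee_fin => a0 ab; exists a; rewrite ?a0. Qed.

(** Stated for length plus cost, so that one induction yields both variances. *)
Definition exp_moment (d : dist R (seq nat * nat)%type) :=
  exists2 s : R, (0 < s)%R & E d (fun ws => (expR (s * wt ws))%:E) < +oo.

Lemma exp_moment_lower (d : dist R (seq nat * nat)%type) (s s' : R) : nn d -> (s' <= s)%R ->
  E d (fun ws => (expR (s * wt ws))%:E) < +oo ->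
  exists2 M : R, (0 <= M)%R & E d (fun ws => (expR (s' * wt ws))%:E) <= M%:E.
Proof.
move=> d0 ss' sfin; set X := E d _ in sfin.
have X0 : 0 <= X by apply: E_ge0 => // ws; rewrite lee_fin expR_ge0.
exists (fine X); first exact: fine_ge0.
rewrite fineK ?ge0_fin_numE//; apply: le_E => // ws.
by rewrite lee_fin ler_expR ler_wpM2r// /wt.
Qed.

Lemma exp_moment_common (d d' : dist R (seq nat * nat)%type) (r : R) (e : nat) :
  nn d -> nn d' -> E d (fun=> 1) = 1 -> E d' (fun=> 1) = 1 -> (0 <= r < 1)%R ->
  exp_moment d -> exp_moment d' ->
  exists s b : R, [/\ (0 < s)%R, (0 <= b)%R, (r * b < 1)%R,
    E d (fun ws => (expR (s * (wt ws + e%:R)))%:E) <= b%:E &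
    E d' (fun ws => (expR (s * (wt ws + e%:R)))%:E) <= b%:E].
Proof.
move=> d0 d0' d1 d1' /andP[r0 r1] [s1 s1gt0 fin1] [s2 s2gt0 fin2].
have min1 : (Num.min s1 s2 <= s1)%R by rewrite ge_min lexx.
have min2 : (Num.min s1 s2 <= s2)%R by rewrite ge_min lexx orbT.
have s0gt0 : (0 < Num.min s1 s2)%R by rewrite lt_min s1gt0.
have [M1 M10 EM1] := exp_moment_lower d0 min1 fin1.
have [M2 M20 EM2] := exp_moment_lower d0' min2 fin2.
set s0 := Num.min s1 s2 in s0gt0 EM1 EM2.
pose N := (expR (s0 * e%:R) * (M1 + M2))%R.
have N0 : (0 <= N)%R by rewrite mulr_ge0 ?expR_ge0// addr_ge0.
have N1 : (0 < 1 + N)%R by lra.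
(* With this choice th N < 1 - r, so b = 1 + th N < 2 - r, and r (2 - r) = 1 - (1 - r)^2 < 1. *)
pose th := ((1 - r) / (1 + N))%R.
have thE : (th * (1 + N) = 1 - r)%R by rewrite /th divfK// gt_eqF.
have th0 : (0 < th)%R by rewrite divr_gt0// subr_gt0.
have th01 : (0 <= th <= 1)%R by rewrite ltW//=; nra.
have EM x : x <= M1%:E \/ x <= M2%:E -> x <= (M1 + M2)%:E.
  by case=> /le_trans; apply; rewrite lee_fin ?lerDl ?lerDr.
exists (th * s0)%R, (1 + th * N)%R; split.
- by rewrite mulr_gt0.
- by rewrite addr_ge0// mulr_ge0// ltW.
- have : (0 <= th * N)%R by rewrite mulr_ge0// ltW.
  nra.
- by apply: E_exp_scale => //; apply: EM; left.
- by apply: E_exp_scale => //; apply: EM; right.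
Qed.

Lemma E_exp_le (d : dist R (seq nat * nat)%type) (s b : R) (x e : nat) : nn d -> (0 < s)%R ->
  (x <= e)%N -> E d (fun ws => (expR (s * (wt ws + e%:R)))%:E) <= b%:E ->
  E d (fun ws => (expR (s * (wt ws + x%:R)))%:E) <= b%:E.
Proof.
move=> d0 s0 xe; apply: le_trans; apply: le_E => // ws.
by rewrite lee_fin ler_expR ler_pM2l// lerD2l ler_nat.
Qed.

Lemma exp_moment_step c k l : (forall X, (c_draw cm X <= c * X.+1)%N) ->
  (k < K)%N -> touches k l ->
  exp_moment (A2 k l) -> exp_moment (A2 k k.+1) -> exp_moment (A2 k.+1 l).
Proof.
move=> cdraw kK t mom mom'; have kK' := ltnW kK.
have d0 := nn_A2 l kK'; have d0' := nn_A2 k.+1 kK'.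
have d1 := E_A2_mass l kK'; have d1' := E_A2_mass k.+1 kK'.
have r01 := rate_lt1 l kK; have /andP[r0 r1] := r01.
pose e := (c_iter cm + c_for cm + c).+1.
have [s [b [s0 b0 rb Eb Eb']]] := exp_moment_common e d0 d0' d1 d1' r01 mom mom'.
set r := rate k l in r01 r0 r1 rb.
have r1' : (0 <= 1 - r)%R by rewrite subr_ge0 ltW.
exists s => //.
pose ex (x : nat) : R := expR (s * x%:R).
have exD x y : ex (x + y)%N = (ex x * ex y)%R by rewrite /ex natrD mulrDr expRD.
have ex0 x : (0 <= ex x)%R by exact: expR_ge0.
have exm x y : (x <= y)%N -> (ex x <= ex y)%R.
  by move=> xy; rewrite ler_expR ler_pM2l// ler_nat.
have Ee x (f : seq nat * nat -> nat) : (x <= e)%N ->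
    (forall ws, f ws = size ws.1 + ws.2 + x)%N ->
    E (A2 k l) (fun ws => (ex (f ws))%:E) <= b%:E /\
    E (A2 k k.+1) (fun ws => (ex (f ws))%:E) <= b%:E.
  move=> xe fE; split; [have := E_exp_le d0 s0 xe Eb|have := E_exp_le d0' s0 xe Eb'];
    by move=> h; apply: le_trans h; apply: le_E => // ws; rewrite /ex /wt fE natrD.
pose G (o : (bool * seq nat) * nat) : \bar R := (ex (size o.1.2 + o.2))%:E.
have G0 : nn G by move=> o; rewrite lee_fin.
(* [A] plays the part of the rejection probability once rounds are weighted by the exponential of
   their cost; r b < 1 keeps it below 1. *)
have [A /andP[A0 Arb] EA] : exists2 A : R, (0 <= A <= r * b)%R &
    E (body k l) (fun o => if stop k l o.1.1 o.1.2 then 0 else (ex o.2)%:E) = A%:E.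
  apply: ge0_le_fin.
    by apply: E_ge0 => [|o]; [exact: nn_body|case: ifP => // _; rewrite lee_fin].
  rewrite (@E_body_rejects k l kK (fun o => (ex o.2)%:E))//; last by move=> o; rewrite lee_fin.
  rewrite [leRHS]EFinM lee_wpmul2l ?lee_fin//.
  have [|//|h _] := Ee (c_iter cm) (fun ws => size ws.1 + ws.2 + c_iter cm)%N.
    by rewrite /e; clear; lia.
  apply: le_trans h; apply: le_E => // vs; case: ifP => _; rewrite lee_fin//.
  by apply: exm => /=; rewrite -addnA leq_addl.
have A1 : (0 <= A < 1)%R by rewrite A0 (le_lt_trans Arb).
have [L _ EL] : exists2 L : R, (0 <= L <= (1 - A)^-1 * b)%R &
    E (loop (body k l) (stop k l)) G = L%:E.
  apply: ge0_le_fin; first by apply: E_ge0 => //; exact/nn_loop/nn_body.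
  rewrite (E_loop_mult (nn_body l kK) G0 (h := fun x => (ex x)%:E) _ A1 _ EA); last 2 first.
  - by move=> x; rewrite lee_fin.
  - by move=> o x y; rewrite /G -EFinM -exD; congr (ex _)%:E; exact: addnCA.
  have iA0 : (0 <= (1 - A)^-1)%R by rewrite invr_ge0 subr_ge0 ltW// (andP A1).2.
  rewrite [leRHS]EFinM lee_wpmul2l ?lee_fin//.
  apply: (@le_trans _ _ (E (body k l) G)).
    by apply: le_E => [|o]; [exact: nn_body|case: ifP].
  rewrite E_body//= -/r.
  have [|//|h _] := Ee (c_iter cm) (fun ws => size ws.1 + (ws.2 + c_iter cm))%N.
  - by rewrite /e; clear; lia.
  - by move=> ws; rewrite addnA.
  rewrite -ge0_muleDl ?lee_fin// -EFinD addrC subrK mul1e.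
  exact: h.
have [be /andP[be0 be_b] Ebe] : exists2 be : R, (0 <= be <= b)%R &
    E (A2 k k.+1) (fun vs => (ex (size (vs.1 ++ [:: k]) + (vs.2 + c_for cm)))%:E) = be%:E.
  apply: ge0_le_fin; first by apply: E_ge0 => // vs; rewrite lee_fin.
  have [||_ //] := Ee (c_for cm).+1 (fun vs => size (vs.1 ++ [:: k]) + (vs.2 + c_for cm))%N.
  - by rewrite /e; clear; lia.
  - by move=> ws; rewrite size_cat /=; clear; lia.
(* Drawing G = j costs at most c (j + 1), which is spread as [c] over each of the j + 1 calls that
   follow. *)
have cbe : (ex c * be <= b)%R.
  rewrite -lee_fin EFinM -Ebe -EZ ?lee_fin//; last by move=> vs; rewrite lee_fin.
  rewrite (eq_E _ (g := fun vs => (ex (c + (size (vs.1 ++ [:: k]) + (vs.2 + c_for cm))))%:E)).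
    have [||_ //] := Ee (c + c_for cm).+1 (fun vs => c + (size (vs.1 ++ [:: k]) + (vs.2 + c_for cm)))%N.
    - by rewrite /e; clear; lia.
    - by move=> ws; rewrite size_cat /=; clear; lia.
  by move=> vs; rewrite [in RHS]exD EFinM.
have Ecalls m : E (callsn cm (A2 k k.+1) k m) (fun xs => (ex (size xs.1 + xs.2))%:E) =
    (be ^+ m)%:E.
  apply: (@E_callsn_mult R cm (A2 k k.+1) k d0' m (fun xs => (ex (size xs.1 + xs.2))%:E) be) => //.
  - by move=> x; rewrite lee_fin.
  - by rewrite /ex /= mulr0 expR0.
  - by move=> xs vs /=; rewrite -EFinM -exD size_cat; congr (ex _)%:E; clear; lia.
(* The first summand is the sum over j of (1 - r) r^j b^(j+1), for R = 1; the second covers R =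
   0. *)
pose kap : R := ((1 - r) * b / (1 - r * b) + ex (c_K0 cm))%R.
have kap1 : (0 <= (1 - r) * b / (1 - r * b))%R.
  by apply: divr_ge0; [rewrite mulr_ge0// subr_ge0 ltW|rewrite subr_ge0 ltW].
have EdK bl : E (dK k l bl) (fun Kc => (ex Kc.2 * be ^+ Kc.1)%:E) <= kap%:E.
  rewrite /dK E_dK ?rate_le1//; last by move=> x; rewrite lee_fin mulr_ge0 ?exprn_ge0.
  case: bl => /=; last by rewrite expr0 mulr1 lee_fin lerDr.
  apply: (@le_trans _ _ ((1 - r) * b / (1 - r * b))%:E); last by rewrite lee_fin lerDl.
  have rb01 : (0 <= r * b < 1)%R by rewrite mulr_ge0.
  rewrite EFinM -esum_geometric// -ge0_esumZl; last 2 first.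
  - by rewrite lee_fin mulr_ge0// subr_ge0 ltW.
  - by move=> j; rewrite lee_fin exprn_ge0// mulr_ge0.
  apply: le_esum => j _; rewrite -!EFinM lee_fin.
  have h : (ex (c_draw cm j) * be ^+ j.+1 <= b ^+ j.+1)%R.
    apply: (@le_trans _ _ ((ex c * be) ^+ j.+1)%R); last first.
      by rewrite lerXn2r// nnegrE mulr_ge0.
    rewrite exprMn ler_wpM2r ?exprn_ge0//.
    apply: (le_trans (exm _ _ (cdraw j))).
    by rewrite /ex natrM mulrA expRM_natr lexx.
  apply: (@le_trans _ _ ((1 - r) * r ^+ j * b ^+ j.+1)%R).
    by rewrite ler_wpM2l// mulr_ge0 ?exprn_ge0// subr_ge0 ltW.
  by rewrite exprMn exprS le_eqVlt; apply/orP; left; apply/eqP; ring.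
pose cc := (c_setup cm + c_end cm)%N.
apply: (@le_lt_trans _ _ ((ex cc)%:E * kap%:E * L%:E)); last by rewrite -!EFinM ltry.
rewrite E_A2S//.
rewrite -EL -EZ//; last 2 first.
- exact/nn_loop/nn_body.
- by rewrite -EFinM lee_fin mulr_ge0// addr_ge0.
apply: le_E => [|o]; first exact/nn_loop/nn_body.
rewrite (eq_E _ (g := fun Kc => (ex cc * ex (size o.1.2 + o.2))%:E *
    (ex Kc.2 * be ^+ Kc.1)%:E)); last first.
  move=> Kc; rewrite (eq_E _ (g := fun xs =>
      (ex cc * ex (size o.1.2 + o.2) * ex Kc.2)%:E * (ex (size xs.1 + xs.2))%:E)); last first.
    move=> xs; rewrite -EFinM -!exD /ex /wt /=; congr (expR (s * _%:R))%:E.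
    by rewrite size_cat /cc; clear; lia.
  rewrite EZ ?lee_fin ?mulr_ge0//; last 2 first.
  - exact: nn_callsn.
  - by move=> x; rewrite lee_fin.
  by rewrite Ecalls -!EFinM; congr _%:E; ring.
rewrite EZ ?lee_fin ?mulr_ge0//; last 2 first.
- exact: nn_dK.
- by move=> x; rewrite lee_fin mulr_ge0 ?exprn_ge0.
have -> : (ex cc)%:E * kap%:E * G o = (ex cc * ex (size o.1.2 + o.2))%:E * kap%:E.
  by rewrite /G -!EFinM; congr _%:E; ring.
by rewrite lee_wpmul2l ?lee_fin ?mulr_ge0.
Qed.

Lemma A2_exp_moment c k l : (forall X, (c_draw cm X <= c * X.+1)%N) -> (k <= K)%N ->
  exp_moment (A2 k l).
Proof.
move=> cdraw; elim: k l => [|k IH] l kK.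
  by exists 1%R => //; rewrite [E _ _]E_dret ?ltry// => x; rewrite lee_fin expR_ge0.
have kK' := ltnW kK; case: (boolP (touches k l)) => t.
  by apply: exp_moment_step cdraw kK t _ _; exact: IH.
by exists 1%R => //; rewrite A2S t [E _ _]E_dret ?ltry// => x; rewrite lee_fin expR_ge0.
Qed.

Lemma finite_var_exp_moment (d : dist R (seq nat * nat)%type) (f : seq nat * nat -> R) :
  nn d -> E d (fun=> 1) = 1 -> exp_moment d -> (forall ws, 0 <= f ws <= wt ws)%R ->
  finite_var f d.
Proof.
move=> d0 d1 [s s0 dfin] fw.
have f0 : nn (fun ws => (f ws)%:E) by move=> ws; rewrite lee_fin; case/andP: (fw ws).
have f20 : nn (fun ws => (f ws ^+ 2)%:E) by move=> ws; rewrite lee_fin sqr_ge0.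
have ex0 : nn (fun ws => (expR (s * wt ws))%:E) by move=> ws; rewrite lee_fin expR_ge0.
have c0 : (0 <= 4 / s ^+ 2)%R by rewrite divr_ge0// exprn_ge0// ltW.
have fx ws : (f ws ^+ 2 <= 4 / s ^+ 2 * expR (s * wt ws))%R.
  have /andP[fw0 fww] := fw ws; have s2 : (0 < s ^+ 2)%R by rewrite exprn_gt0.
  have h : ((s * wt ws) ^+ 2 <= 4 * expR (s * wt ws))%R.
    by apply: sqr_le_expR; rewrite mulr_ge0 ?wt_ge0// ltW.
  rewrite mulrAC ler_pdivlMr//; apply: le_trans h.
  by rewrite exprMn mulrC ler_pM2l// lerXn2r// nnegrE wt_ge0.
have Ef2 : E d (fun ws => (f ws ^+ 2)%:E) < +oo.
  apply: (@le_lt_trans _ _ (E d (fun ws => (4 / s ^+ 2)%:E * (expR (s * wt ws))%:E))).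
    by apply: le_E => // ws; rewrite -EFinM lee_fin.
  by rewrite EZ// lte_mul_pinfty.
split.
  apply: (@le_lt_trans _ _ (E d (fun ws => 1 + (f ws ^+ 2)%:E))).
    apply: le_E => // ws; rewrite -EFinD lee_fin.
    by have := sqr_ge0 (f ws - 1)%R; have /andP[+ _] := fw ws; nra.
  by rewrite ED// d1 lte_add_pinfty// ltry.
set m := fine _.
apply: (@le_lt_trans _ _ (E d (fun ws => (2 * m ^+ 2)%:E * 1 + 2%:E * (f ws ^+ 2)%:E))).
  apply: le_E => // ws; rewrite -!EFinM -EFinD lee_fin.
  by have := sqr_ge0 (f ws + m)%R; nra.
have m0 : (0 <= 2 * m ^+ 2)%R by rewrite mulr_ge0// sqr_ge0.
rewrite ED//; last 2 first.
- by move=> ws; rewrite mule1 lee_fin.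
- by move=> ws; rewrite -EFinM lee_fin mulr_ge0// sqr_ge0.
rewrite !EZ// d1 lte_add_pinfty ?mule1 ?ltry//.
by rewrite lte_mul_pinfty.
Qed.

(** * Mean output length and mean number of steps *)

(** The quotient of [mean_size] by [mass] is p times the logarithmic derivative of mu_{S \ T} /
    mu_S, which separates into a difference. *)
Lemma E_A2_size k l : (k <= K)%N ->
  E (A2 k l) (fun ws => (size ws.1)%:R%:E) =
  (p * (mu' k [pred b | ~~ Rel l.-1 b] / mu k [pred b | ~~ Rel l.-1 b] -
        mu' k predT / mu k predT))%:E.
Proof.
move=> kK; rewrite (@E_A2_law k l (fun w => (size w)%:R%:E))//.
rewrite (E_lam_size Rel_refl Rel_sym p_gt0 mu_gt0)// -EFinM; congr _%:E.
have e : minus predT (Rel l.-1) = [pred b | ~~ Rel l.-1 b] by [].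
rewrite /mass /mean_size -!e.
by field; rewrite !gt_eqF ?mu_gt0.
Qed.

Lemma E_A2_cost_step c k l (B1 B2 B : R) : cost_bounded c cm -> (k < K)%N -> touches k l ->
  (0 <= B1 <= B)%R -> (0 <= B2 <= B)%R ->
  E (A2 k l) (fun ws => ws.2%:R%:E) = B1%:E ->
  E (A2 k k.+1) (fun ws => ws.2%:R%:E) = B2%:E ->
  E (A2 k.+1 l) (fun ws => ws.2%:R%:E) <= ((B + 5 * c%:R) / (1 - rate k l))%:E.
Proof.
move=> [_ [csetup [citer [cK0 [cfor [cend cdraw]]]]]] kK t /andP[B10 B1B] /andP[B20 B2B] EB1 EB2.
have kK' := ltnW kK.
have d0 := nn_A2 l kK'; have d0' := nn_A2 k.+1 kK'.
have d1 := E_A2_mass l kK'; have d1' := E_A2_mass k.+1 kK'.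
have r01 := rate_lt1 l kK; have /andP[r0 r1] := r01.
have /andP[rho0 rhor] := reject_rate_le kK d1.
have Erho := reject_rateE kK d1; set rho := reject_rate k l in rho0 rhor Erho.
have Ebool := E_loop_bool kK d1; rewrite -/rho in Ebool.
set r := rate k l in r01 r0 r1 rhor Ebool *.
have r1' : (0 < 1 - r)%R by rewrite subr_gt0.
have rho01 : (0 <= rho < 1)%R by rewrite rho0 (le_lt_trans rhor).
have rho1' : (0 < 1 - rho)%R by rewrite subr_gt0; case/andP: rho01.
have nR (x y : nat) : (x <= y)%N -> (x%:R <= y%:R :> R)%R by rewrite ler_nat.
have nnL := nn_loop (stop k l) (nn_body l kK).
have nat0 (A : Type) (f : A -> nat) : nn (fun x => (f x)%:R%:E : \bar R).
  by move=> x; rewrite lee_fin.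
have Ebody : E (body k l) (fun o => o.2%:R%:E) = (B1 + (c_iter cm)%:R)%:E.
  rewrite E_body//= -/r -ge0_muleDl ?lee_fin ?(ltW r1')// -EFinD addrC subrK mul1e.
  rewrite (eq_E _ (g := fun vs => (c_iter cm)%:R%:E * 1 + vs.2%:R%:E)).
    by rewrite ED ?EZ ?lee_fin// d1 EB1 mule1 -EFinD addrC.
  by move=> vs; rewrite mule1 -EFinD natrD addrC.
have Eloop := E_loop_cost (nn_body l kK) rho01 (E_body1 kK d1) Erho Ebody.
(* Given R = 1, K has mean 1 / (1 - r), and each unit of K costs at most [B] for a call, [c] for the
   for loop and [c] for the draw. *)
pose D := ((2 * c%:R + B) / (1 - r))%R.
have D0 : (0 <= D)%R by rewrite divr_ge0 ?(ltW r1')// addr_ge0 ?mulr_ge0// (le_trans B10).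
rewrite E_A2S//.
(* The constant 3c pays for [c_setup], [c_end] and [c_K0]. *)
apply: (@le_trans _ _ (E (loop (body k l) (stop k l)) (fun o => (3 * c%:R)%:E * 1 +
    (o.2%:R%:E + D%:E * (if o.1.1 then 1 else 0))))).
  apply: le_E => // o; rewrite (eq_E _ (g := fun Kc =>
    ((c_setup cm + o.2 + c_end cm + Kc.2)%:R + Kc.1%:R * (B2 + (c_for cm)%:R))%:E)); last first.
    move=> Kc; rewrite (eq_E _ (g := fun xs =>
        (c_setup cm + o.2 + c_end cm + Kc.2)%:R%:E * 1 + xs.2%:R%:E)); last first.
      by move=> xs /=; rewrite mule1 -EFinD -natrD; congr (_%:R)%:E; clear; lia.
    have nnc := nn_callsn cm k d0' Kc.1.
    rewrite ED// EZ ?lee_fin// (E_callsn_mass _ _ d0' _ d1') (E_callsn_cost _ _ d0' _ d1' B20 EB2).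
    by rewrite mule1 -EFinD.
  have z0 : ((c_setup cm + o.2 + c_end cm)%:R <= 2 * c%:R + o.2%:R :> R)%R.
    by rewrite -natrM -natrD ler_nat; move: csetup cend; clear; lia.
  rewrite /dK E_dK ?rate_le1//; last first.
    by move=> Kc; rewrite lee_fin addr_ge0// mulr_ge0// addr_ge0.
  rewrite -/r; case: (o.1.1) => /=; last first.
    rewrite mul0r addr0 mule0 adde0 mule1 -EFinD lee_fin natrD.
    by have := nR _ _ cK0; lra.
  have js j : (0 <= j.+1%:R * r ^+ j)%R by rewrite mulr_ge0 ?exprn_ge0.
  have pj j : (0 <= r ^+ j)%R by rewrite exprn_ge0.
  apply: (@le_trans _ _ (\esum_(j in [set: nat])
      (((1 - r) * (c_setup cm + o.2 + c_end cm)%:R)%:E * (r ^+ j)%:E +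
       ((1 - r) * (2 * c%:R + B))%:E * (j.+1%:R * r ^+ j)%:E))).
    apply: le_esum => j _; rewrite -!EFinM -EFinD lee_fin.
    have h : ((c_draw cm j)%:R + j.+1%:R * (B2 + (c_for cm)%:R) <= j.+1%:R * (2 * c%:R + B))%R.
      have := nR _ _ (cdraw j); rewrite natrM mulrC => h1.
      have : (j.+1%:R * (B2 + (c_for cm)%:R) <= j.+1%:R * (B + c%:R))%R.
        by rewrite ler_wpM2l// lerD// nR.
      lra.
    have q0 : (0 <= (1 - r) * r ^+ j)%R by rewrite mulr_ge0 ?(ltW r1').
    have := ler_wpM2l q0 h; rewrite natrD; lra.
  have a0 : (0 <= (1 - r) * (c_setup cm + o.2 + c_end cm)%:R)%R by rewrite mulr_ge0 ?(ltW r1').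
  have b0 : (0 <= (1 - r) * (2 * c%:R + B))%R.
    by rewrite mulr_ge0 ?(ltW r1')// addr_ge0 ?mulr_ge0// (le_trans B10).
  rewrite esumD; [|by move=> j _; rewrite -EFinM lee_fin mulr_ge0..].
  rewrite !ge0_esumZl ?lee_fin// esum_geometric// esum_geometric_deriv//.
  rewrite mule1 mule1 -!EFinM -!EFinD lee_fin.
  have -> : ((1 - r) * (c_setup cm + o.2 + c_end cm)%:R / (1 - r) =
      (c_setup cm + o.2 + c_end cm)%:R)%R by field; rewrite gt_eqF.
  have -> : ((1 - r) * (2 * c%:R + B) / (1 - r) ^+ 2 = D)%R.
    by rewrite /D; field; rewrite gt_eqF.
  have : (0 <= c%:R :> R)%R by [].
  lra.
have bool0 : nn (fun o : (bool * seq nat) * nat => if o.1.1 then 1 else 0 : \bar R).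
  by move=> o; case: ifP.
have Db0 : nn (fun o : (bool * seq nat) * nat => D%:E * (if o.1.1 then 1 else 0)).
  by move=> o; rewrite mule_ge0// lee_fin.
rewrite ED//; last by move=> o; apply: adde_ge0 (Db0 o); rewrite lee_fin.
have E3 : E (loop (body k l) (stop k l)) (fun=> (3 * c%:R)%:E * 1) = (3 * c%:R)%:E.
  by rewrite EZ ?lee_fin ?mulr_ge0// (E_loop1 kK d1) mule1.
have EDb : E (loop (body k l) (stop k l)) (fun o => D%:E * (if o.1.1 then 1 else 0)) =
    (D * ((r - rho) / (1 - rho)))%:E.
  by rewrite EZ ?lee_fin// Ebool.
rewrite ED// E3 EDb Eloop -!EFinD lee_fin.
have h : ((1 - rho)^-1 * (B1 + (c_iter cm)%:R) <= (1 - rho)^-1 * (2 * c%:R + B))%R.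
  rewrite ler_wpM2l ?invr_ge0 ?(ltW rho1')//.
  have := nR _ _ citer; have : (0 <= c%:R :> R)%R by []. lra.
(* The unknown [rho] disappears here: rounds and calls have the same unit bound 2c + B, and their
   mean numbers add up to 1 / (1 - r). *)
have e : ((1 - rho)^-1 * (2 * c%:R + B) + D * ((r - rho) / (1 - rho)) = (2 * c%:R + B) / (1 - r))%R.
  by rewrite /D; field; rewrite !gt_eqF.
have h3 : (3 * c%:R <= 3 * c%:R / (1 - r))%R.
  have c30 : (0 <= 3 * c%:R :> R)%R by rewrite mulr_ge0.
  by rewrite ler_pdivlMr// ler_piMr// lerBlDr lerDl.
have -> : ((B + 5 * c%:R) / (1 - r) = 3 * c%:R / (1 - r) + (2 * c%:R + B) / (1 - r))%R by ring.
lra.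
Qed.

(** Multiplied by mu_k(p), the bound starts at [c], for the trivial exit, and grows by at most 5c
    per level, since mu_k(p) <= 1. *)
Lemma E_A2_cost c k l : cost_bounded c cm -> (k <= K)%N ->
  E (A2 k l) (fun ws => ws.2%:R%:E) <= ((c + 5 * c * k)%:R / mu k predT)%:E.
Proof.
move=> cb; have ctriv := cb.1.
have triv k' l' : (k' <= K)%N -> E (dret ([::], c_triv cm)) (fun ws => ws.2%:R%:E) <=
    ((c + 5 * c * k')%:R / mu k' predT)%:E.
  move=> kK; rewrite E_dret; last by move=> x; rewrite lee_fin.
  rewrite lee_fin /= ler_pdivlMr ?mu_gt0//; apply: (@le_trans _ _ (c%:R)%R); last first.
    by rewrite ler_nat leq_addr.
  rewrite -[leRHS]mulr1; apply: ler_pM.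
  - exact: ler0n.
  - exact/ltW/mu_gt0.
  - by rewrite ler_nat.
  - exact: mu_le1.
elim: k l => [|k IH] l kK; first exact: triv.
case: (boolP (touches k l)) => t; last by rewrite A2S t; exact: triv.
have kK' := ltnW kK.
have cost0 l' : 0 <= E (A2 k l') (fun ws => ws.2%:R%:E).
  by apply: E_ge0 => [|ws]; [exact: nn_A2|rewrite lee_fin].
have [B1 B1B EB1] := ge0_le_fin (cost0 l) (IH l kK').
have [B2 B2B EB2] := ge0_le_fin (cost0 k.+1) (IH k.+1 kK').
apply: le_trans (E_A2_cost_step cb kK t B1B B2B EB1 EB2) _; rewrite lee_fin.
have m0 := mu_gt0 predT kK'; have m1 := mu_gt0 predT kK.
have /andP[r0 r1] := rate_lt1 l kK.
(* An equality when the component is hit; when r = 0 it follows from mu_{k+1}(p) <= mu_k(p). *)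
have rr : ((1 - rate k l)^-1 <= mu k predT / mu k.+1 predT)%R.
  rewrite -[leRHS]invrK lef_pV2 ?posrE ?subr_gt0 ?invr_gt0 ?divr_gt0//.
  rewrite invf_div /rate; case: ifP => _; first by rewrite subKr.
  by rewrite subr0 ler_pdivrMr// mul1r mu_le.
set B := ((c + 5 * c * k)%:R / mu k predT)%R.
have B0 : (0 <= B + 5 * c%:R)%R.
  by apply: addr_ge0; [apply: divr_ge0 => //; exact: ltW|exact: mulr_ge0].
apply: le_trans (ler_wpM2l B0 rr) _.
rewrite mulrA ler_pM2r ?invr_gt0// mulrDl /B divfK ?gt_eqF//.
have : (5 * c%:R * mu k predT <= 5 * c%:R * 1 :> R)%R.
  by rewrite ler_wpM2l ?mulr_ge0// mu_le1.
rewrite (_ : (c + 5 * c * k.+1 = c + 5 * c * k + 5 * c)%N); last by rewrite mulnS addnA addnAC.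
by rewrite (natrD _ (c + 5 * c * k)) (natrM _ 5 c); lra.
Qed.

End Algorithm.

(** * Dependence on the relation restricted to the alphabet *)

Section Locality.
Variables (n : nat) (Rel Rel' : rel nat).
Hypothesis Rel_eq : forall a b, (a < n)%N -> (b < n)%N -> Rel a b = Rel' a b.

Lemma local_mu_poly (F : nzRingType) k (P : pred nat) : (k <= n)%N ->
  @mu_poly Rel F k P = mu_poly Rel' F k P.
Proof.
move=> kn; apply: eq_bigl => A; congr (_ && _).
apply: eq_forallb => a; congr (_ ==> _); apply: eq_forallb => b.
by rewrite Rel_eq ?(leq_trans (ltn_ord _)).
Qed.

Lemma local_mu (R : realType) (p : R) k (P : pred nat) : (k <= n)%N ->
  mu Rel p k P = mu Rel' p k P.
Proof. by move=> kn; rewrite /mu local_mu_poly. Qed.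

Lemma local_mu' (R : realType) (p : R) k (P : pred nat) : (k <= n)%N ->
  mu' Rel p k P = mu' Rel' p k P.
Proof. by move=> kn; rewrite /mu' local_mu_poly. Qed.

Lemma local_A2 (R : realType) (cm : cost_model) (p : R) k l : (k <= n)%N -> (l.-1 < n)%N ->
  A2 Rel cm p k l = A2 Rel' cm p k l.
Proof.
elim: k l => [//|k IH] l kn ln; have kn' := ltnW kn.
have ord_n (i : 'I_k.+1) : (i < n)%N by exact: leq_trans (ltn_ord i) kn.
have touchesE : touches Rel k l = touches Rel' k l.
  by apply: eq_existsb => i; rewrite Rel_eq.
have hitE : hit Rel k l = hit Rel' k l.
  apply: eq_existsb => i; rewrite Rel_eq//; congr (_ && _).
  by apply: eq_connect => x y; rewrite Rel_eq.
have rateE : rate Rel p k l = rate Rel' p k l by rewrite /rate hitE !local_mu.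
have stopE : stop Rel k l = stop Rel' k l.
  apply/funext => b; apply/funext => v; rewrite /stop Rel_eq//; congr (_ || ~~ _).
  apply: eq_all => x; case: (ltnP x k) => //= xk.
  by rewrite Rel_eq// (ltn_trans xk).
rewrite (A2S Rel cm p k l) (A2S Rel' cm p k l) touchesE stopE.
by rewrite /body /dK rateE (IH l kn' ln) (IH k.+1 kn' kn).
Qed.

Lemma local_below_pS (R : rcfType) k (p : R) : (k <= n)%N ->
  below_pS Rel k p -> below_pS Rel' k p.
Proof. by move=> kn bp z; rewrite -local_mu_poly//; exact: bp. Qed.

Lemma local_tr_eq x y : all (fun a => (a < n)%N) x -> tr_eq Rel x y -> tr_eq Rel' x y.
Proof.
move=> + xy; elim: xy => [u v [s [t [a [b [ab [-> ->]]]]]]|u|u v w uv IHuv _ IHvw] un.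
- move: un; rewrite all_cat /= => /and4P[_ an bn _].
  by apply: Relation_Operators.rt_step; exists s, t, a, b; rewrite -Rel_eq.
- exact: tr_refl.
- by apply: tr_trans (IHuv un) (IHvw _); rewrite -(tr_all _ uv).
Qed.

End Locality.

(** * From a relation on the alphabet to a reflexive symmetric one on all numbers *)

Section Transfer.
Variables (n : nat) (Rel : rel nat).
Hypothesis Rel_refl : forall a, (a < n)%N -> Rel a a.
Hypothesis Rel_sym : forall a b, (a < n)%N -> (b < n)%N -> Rel a b = Rel b a.

(* [Rel] is arbitrary outside the alphabet; making the letters [>= n] dependent
   on all others gives a relation that is reflexive and symmetric on [nat]. *)
Definition extended_rel : rel nat := fun a b => ((a < n)%N && (b < n)%N) ==> Rel a b.

Lemma extended_relE a b : (a < n)%N -> (b < n)%N -> Rel a b = extended_rel a b.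
Proof. by rewrite /extended_rel => -> ->. Qed.

Lemma extended_rel_refl : reflexive extended_rel.
Proof. by move=> a; apply/implyP => /andP[an _]; exact: Rel_refl. Qed.

Lemma extended_rel_sym : symmetric extended_rel.
Proof.
move=> a b; rewrite /extended_rel andbC; case: (boolP (_ && _)) => //= /andP[bn an].
exact: Rel_sym.
Qed.

Let local := extended_relE.
Let local' a b (an : (a < n)%N) (bn : (b < n)%N) := esym (extended_relE an bn).

Lemma extended_tr_eq x y : all (fun a => (a < n)%N) x ->
  tr_eq Rel x y <-> tr_eq extended_rel x y.
Proof. by move=> xn; split; [exact: (local_tr_eq local xn)|exact: (local_tr_eq local' xn)]. Qed.

Lemma extended_tr_nf x : all (fun a => (a < n)%N) x -> tr_nf Rel x <-> tr_nf extended_rel x.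
Proof.
by move=> xn; split=> nf y /(extended_tr_eq y xn); exact: nf.
Qed.

Lemma extended_maxl a x : (a < n)%N -> all (fun b => (b < n)%N) x ->
  maxl Rel x `<=` Lset Rel a <-> maxin extended_rel (extended_rel a) x.
Proof.
move=> an xn; have maxE b : maxl Rel x b <-> is_max extended_rel x b.
  split=> [[y /(extended_tr_eq _ xn) xy]|/(maxlP extended_rel_sym) [y xy]].
    by apply/(maxlP extended_rel_sym); exists y.
  by exists y; apply/extended_tr_eq.
split=> [h|/maxinP h b /maxE bmax].
  apply/maxinP => b bmax; rewrite -extended_relE//; last exact: allP xn _ (is_max_mem bmax).
  exact/h/maxE.
by rewrite /Lset /= extended_relE ?h//; exact: allP xn _ (is_max_mem bmax).
Qed.

Lemma out_probE (R : realType) (d : dist R (seq nat * nat)%type) x :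
  out_prob Rel d x = E d (fun ws => ind R Rel x ws.1).
Proof.
rewrite /out_prob esum_mkcond; apply: eq_esum => ws _; rewrite /ind.
case: asboolP => h; first by rewrite mem_set// mule1.
by rewrite memNset// mule0.
Qed.

Section AtParameter.
Variables (R : realType) (cm : cost_model) (p : R) (k l : nat).
Hypotheses (kn : (k <= n)%N) (ln : (l.-1 < n)%N) (p_gt0 : 0 < p).
Hypothesis below_p : below_pS Rel k p.
Local Notation Rel' := extended_rel.

Lemma extended_mu_gt0 j (P : pred nat) : (j <= k)%N -> 0 < mu Rel' p j P.
Proof.
apply: (below_pS_mu_gt0 extended_rel_refl extended_rel_sym _ p_gt0).
exact: (local_below_pS local kn below_p).
Qed.

Lemma extended_Bmax :
  Bmax Rel p k (Lset Rel l.-1) =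
  (mu Rel' p k predT * mass Rel' p k predT (Rel' l.-1))%:E.
Proof.
have kk := leqnn k.
rewrite EFinM -(E_lam_mass extended_rel_refl extended_rel_sym p_gt0 extended_mu_gt0)//.
rewrite -(BmaxE extended_rel_refl extended_rel_sym p_gt0); last exact/ltW/extended_mu_gt0.
rewrite /Bmax (local_mu local)//; congr (esum _ _); apply/seteqP; split=> y /= [nfy [yk ymax]].
  have yn : all (fun a => (a < n)%N) y.
    by apply: sub_all yk => i /= ik; exact: leq_trans ik kn.
  split; first exact/(extended_tr_nf yn).
  split=> // b /(maxlP extended_rel_sym).
  by move/(extended_maxl ln yn)/maxinP: ymax; apply.
have yn : all (fun a => (a < n)%N) y.
  by apply: sub_all yk => i /= ik; exact: leq_trans ik kn.
split; first exact/(extended_tr_nf yn).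
split=> //; apply/(extended_maxl ln yn)/maxinP => b /(maxlP extended_rel_sym).
exact: ymax.
Qed.

Lemma A2_law x :
  out_prob Rel (A2 Rel cm p k l) x = (Dlaw Rel p k (Lset Rel l.-1) x)%:E.
Proof.
have kk := leqnn k; have ind0 := ind_ge0 R Rel x.
rewrite out_probE (local_A2 local)//.
rewrite (E_A2_law _ extended_rel_refl extended_rel_sym p_gt0 extended_mu_gt0)//.
(* A word [x] with a letter outside Sigma_k is handled before the two relations are compared:
   equivalence preserves letters, so both sides vanish. *)
rewrite /Dlaw; have [xk|xk] := boolP (all (fun a => (a < k)%N) x); last first.
  transitivity ((mass Rel' p k predT (Rel' l.-1))^-1%:E *
      E (lam Rel' p k predT (Rel' l.-1)) (fun=> 0))%E; last by rewrite E0 mule0.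
  congr (_ * _)%E; apply: (carried_lam extended_rel_sym (ltW p_gt0)) => // w [wk _ _].
  by apply: (@ind_all0 _ _ (fun a => (a < k)%N)); rewrite wk eq_sym; case: all xk.
have xn : all (fun a => (a < n)%N) x.
  by apply: sub_all xk => i /= ik; exact: leq_trans ik kn.
have indE w : ind R Rel x w = ind R Rel' x w.
  rewrite /ind; congr (if _ then _ else _); apply/asboolP/asboolP => wx.
    by apply/extended_tr_eq => //; rewrite (tr_all _ wx).
  by apply/extended_tr_eq => //; rewrite (tr_all _ wx).
rewrite (eq_E _ indE) (E_lam_ind extended_rel_refl extended_rel_sym p_gt0) xk.
rewrite extended_Bmax (local_mu local)//=.
have m0 := extended_mu_gt0 predT kk.
have w0 : mass Rel' p k predT (Rel' l.-1) != 0.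
  by rewrite gt_eqF// (mass_gt0 extended_mu_gt0).
have -> : `[< maxl Rel x `<=` Lset Rel l.-1 >] = maxin Rel' (Rel' l.-1) x.
  by apply/asboolP/idP => /(extended_maxl ln xn).
case: ifP => _; last by rewrite mule0.
by rewrite -EFinM; congr _%:E; field; rewrite w0 gt_eqF.
Qed.

Lemma A2_mean_size :
  Ex (fun ws : seq nat * nat => (size ws.1)%:R) (A2 Rel cm p k l) =
  (p * (mu' Rel p k [pred b | ~~ Rel l.-1 b] / mu Rel p k [pred b | ~~ Rel l.-1 b] -
        mu' Rel p k predT / mu Rel p k predT))%:E.
Proof.
rewrite /Ex -/(E _ _) (local_A2 local)//.
rewrite (E_A2_size _ extended_rel_refl extended_rel_sym p_gt0 extended_mu_gt0)//.
have notE i : (i < k)%N -> [pred b | ~~ Rel l.-1 b] i = [pred b | ~~ Rel' l.-1 b] i.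
  by move=> ik; rewrite /= extended_relE// (leq_trans ik).
by rewrite !(local_mu local)// !(local_mu' local)// (eq_mu _ _ notE) (eq_mu' _ _ notE).
Qed.

Lemma A2_finite_var c (f : seq nat * nat -> R) : cost_bounded c cm ->
  (forall ws, 0 <= f ws <= (size ws.1 + ws.2)%:R) -> finite_var f (A2 Rel cm p k l).
Proof.
move=> [_ [_ [_ [_ [_ [_ cdraw]]]]]] fw; rewrite (local_A2 local)//.
have kk := leqnn k; apply: finite_var_exp_moment fw.
- exact: nn_A2 extended_rel_refl extended_rel_sym p_gt0 _ extended_mu_gt0 _ _ kk.
- exact: E_A2_mass extended_rel_refl extended_rel_sym p_gt0 _ extended_mu_gt0 _ _ kk.
- exact: A2_exp_moment extended_rel_refl extended_rel_sym p_gt0 _ extended_mu_gt0 _ _ _ cdraw kk.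
Qed.

Lemma A2_mean_cost c : cost_bounded c cm ->
  (Ex (fun ws : seq nat * nat => ws.2%:R) (A2 Rel cm p k l)
    <= ((6 * c)%:R * (maxn k 1)%:R / mu Rel p k predT)%:E)%E.
Proof.
move=> cb; rewrite /Ex -/(E _ _) (local_A2 local)// (local_mu local)//.
apply: le_trans (E_A2_cost extended_rel_refl extended_rel_sym p_gt0 extended_mu_gt0 l cb (leqnn k)) _.
rewrite lee_fin ler_pM2r ?invr_gt0 ?extended_mu_gt0// -natrM ler_nat.
(* c + 5 c k <= 6 c max(k, 1), the maximum taking care of k = 0. *)
by case: k => [|k'] /=; rewrite ?maxn1; nia.
Qed.

End AtParameter.
End Transfer.

Theorem theorem2p2 :
  (forall (R : realType) (n : nat) (Rel : rel nat) (c : nat) (cm : cost_model)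
          (k l : nat) (p : R),
    (forall a, (a < n)%N -> Rel a a) ->
    (forall a b, (a < n)%N -> (b < n)%N -> Rel a b = Rel b a) ->
    (k < l)%N -> (l <= n)%N ->
    0 < p -> below_pS Rel k p ->
    cost_bounded c cm ->
    let d := A2 Rel cm p k l in
    let notL := [pred b | ~~ Rel l.-1 b] in
    [/\ forall x : seq nat,
          out_prob Rel d x = (Dlaw Rel p k (Lset Rel l.-1) x)%:E,
        finite_var (fun ws : seq nat * nat => (size ws.1)%:R) d,
        finite_var (fun ws : seq nat * nat => (ws.2)%:R) d
      & Ex (fun ws : seq nat * nat => (size ws.1)%:R) d =
          (p * (mu' Rel p k notL / mu Rel p k notL
                - mu' Rel p k predT / mu Rel p k predT))%:E]) /\
  (forall c : nat, exists C : nat,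
    forall (R : realType) (n : nat) (Rel : rel nat) (cm : cost_model)
           (k l : nat) (p : R),
    (forall a, (a < n)%N -> Rel a a) ->
    (forall a b, (a < n)%N -> (b < n)%N -> Rel a b = Rel b a) ->
    (k < l)%N -> (l <= n)%N ->
    0 < p -> below_pS Rel k p ->
    cost_bounded c cm ->
    (Ex (fun ws : seq nat * nat => (ws.2)%:R) (A2 Rel cm p k l)
      <= (C%:R * (maxn k 1)%:R / mu Rel p k predT)%:E)%E).
Proof.
split=> [R n Rel c cm k l p Rel_refl Rel_sym kl ln p0 bp cb d notL|c].
  have kn : (k <= n)%N by exact: leq_trans (ltnW kl) ln.
  have ln' : (l.-1 < n)%N by rewrite prednK// (leq_ltn_trans _ kl).
  split.
  - exact: (A2_law Rel_refl Rel_sym cm kn ln' p0 bp).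
  - apply: (A2_finite_var Rel_refl Rel_sym kn ln' p0 bp cb) => ws.
    by rewrite ler0n ler_nat leq_addr.
  - apply: (A2_finite_var Rel_refl Rel_sym kn ln' p0 bp cb) => ws.
    by rewrite ler0n ler_nat leq_addl.
  - exact: (A2_mean_size Rel_refl Rel_sym cm kn ln' p0 bp).
exists (6 * c)%N => R n Rel cm k l p Rel_refl Rel_sym kl ln p0 bp cb.
have kn : (k <= n)%N by exact: leq_trans (ltnW kl) ln.
have ln' : (l.-1 < n)%N by rewrite prednK// (leq_ltn_trans _ kl).
exact: (A2_mean_cost Rel_refl Rel_sym kn ln' p0 bp cb).
Qed.
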